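(* Let $R$ be a ring and let $n>0$ be an integer. Then $({\rm dw}\widetilde{\mathcal{F}_n},({\rm dw}\widetilde{\mathcal{F}_n})^\perp)$ and $({\rm ex}\widetilde{\mathcal{F}_n},({\rm ex}\widetilde{\mathcal{F}_n})^\perp)$ are complete cotorsion pairs in ${\rm Ch}(R\text{-}{\rm Mod})$.
   Context: ${\rm Ch}(R\text{-}{\rm Mod})$ is the category of (unbounded) chain complexes of left $R$-modules. $\mathcal{F}_n$ is the class of left $R$-modules of flat dimension at most $n$, i.e. modules $M$ admitting an exact sequence $0\to F_n\to\cdots\to F_0\to M\to 0$ with all $F_k$ flat. ${\rm dw}\widetilde{\mathcal{F}_n}$ is the class of complexes $X$ with $X_m\in\mathcal{F}_n$ for all $m\in\mathbb{Z}$, and ${\rm ex}\widetilde{\mathcal{F}_n}$ is the class of exact complexes in ${\rm dw}\widetilde{\mathcal{F}_n}$. Orthogonals are with respect to ${\rm Ext}^1$ in ${\rm Ch}(R\text{-}{\rm Mod})$: $\mathcal{X}^\perp=\{Z:{\rm Ext}^1(X,Z)=0\ \forall X\in\mathcal{X}\}$ and ${}^\perp\mathcal{X}=\{Z:{\rm Ext}^1(Z,X)=0\ \forall X\in\mathcal{X}\}$. A pair $(\mathcal{X},\mathcal{Y})$ is a cotorsion pair if $\mathcal{X}={}^\perp\mathcal{Y}$ and $\mathcal{Y}=\mathcal{X}^\perp$. It is complete if for every object $Z$ there are short exact sequences $0\to B\to A\to Z\to 0$ and $0\to Z\to B'\to A'\to 0$ with $A,A'\in\mathcal{X}$ and $B,B'\in\mathcal{Y}$.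 *)

(* Defs.v *)
(* Left R-modules are [lmodType R]; right R-modules are left modules over the
   converse ring, [lmodType R^c]. *)
From HB Require Import structures.
From mathcomp Require Import all_boot all_algebra.
From mathcomp Require Import boolp.

Set Implicit Arguments.
Unset Strict Implicit.
Unset Printing Implicit Defensive.

Import GRing.Theory.
Local Open Scope ring_scope.
Local Open Scope quotient_scope.

Section Flat.
Variable R : pzRingType.

(* In the last clause [(r : R^c) *: a] is the right action a.r, so the clause
   reads t (a.r, x) = t (a, r x). *)
Definition balanced (A : lmodType R^c) (F : lmodType R) (G : zmodType)
    (t : A -> F -> G) : Prop :=
  [/\ forall a a' x, t (a + a') x = t a x + t a' x,
      forall a x x', t a (x + x') = t a x + t a x'
    & forall a (r : R) x, t ((r : R^c) *: a) x = t a (r *: x)].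

(* (T, t) is a tensor product of A and F over R. *)
Definition is_tensor (A : lmodType R^c) (F : lmodType R) (T : zmodType)
    (t : A -> F -> T) : Prop :=
  balanced t /\
  forall (G : zmodType) (g : A -> F -> G), balanced g ->
    (exists h : {additive T -> G}, forall a x, h (t a x) = g a x) /\
    (forall h h' : {additive T -> G},
       (forall a x, h (t a x) = g a x) ->
       (forall a x, h' (t a x) = g a x) -> h =1 h').

(* F is flat if - (x) F preserves injectivity of maps of right R-modules; here
   h is the induced map f (x) F.  See [tensor_exists] for the existence of the
   tensor products that are quantified over. *)
Definition flat (F : lmodType R) : Prop :=
  forall (A B : lmodType R^c) (f : {linear A -> B}), injective f ->
  forall (TA TB : zmodType) (tA : A -> F -> TA) (tB : B -> F -> TB),
    is_tensor tA -> is_tensor tB ->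
  forall h : {additive TA -> TB},
    (forall a x, h (tA a x) = tB (f a) x) -> injective h.

(* The modules F k with k > n are zero, so that exactness at F n says that
   F n -> F (n - 1) (or F 0 -> M if n = 0) is injective. *)
Definition flat_dim_le (n : nat) (M : lmodType R) : Prop :=
  exists (F : nat -> lmodType R) (d : forall k, {linear F k.+1 -> F k})
         (e : {linear F 0%N -> M}),
    [/\ forall k, (k <= n)%N -> flat (F k),
        forall k, (n < k)%N -> forall x : F k, x = 0,
        forall y : M, exists x, e x = y,
        forall x : F 0%N, e x = 0 <-> exists y, d 0%N y = x
      & forall k (x : F k.+1), d k x = 0 <-> exists y, d k.+1 y = x].

End Flat.

Section TensorExistence.
Variables (R : pzRingType) (A : lmodType R^c) (F : lmodType R).

(* Formal sums of elementary tensors, identified when every balanced map takes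
   the same value on them. *)
Let ev (G : zmodType) (g : A -> F -> G) (s : seq (A * F)) : G :=
  \sum_(p <- s) g p.1 p.2.

Definition tensor_rel (s s' : seq (A * F)) : bool :=
  `[< forall (G : zmodType) (g : A -> F -> G), balanced g -> ev g s = ev g s' >].

Lemma tensor_rel_refl : reflexive tensor_rel.
Proof. by move=> s; apply/asboolP. Qed.

Lemma tensor_rel_sym : symmetric tensor_rel.
Proof. by move=> s s'; apply/asboolP/asboolP => h G g /h ->. Qed.

Lemma tensor_rel_trans : transitive tensor_rel.
Proof.
move=> s2 s1 s3 /asboolP h /asboolP h'; apply/asboolP => G g hg.
by rewrite h // h'.
Qed.

Canonical tensor_equiv :=
  EquivRel tensor_rel tensor_rel_refl tensor_rel_sym tensor_rel_trans.

Definition tensor : Type := {eq_quot tensor_equiv}.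
HB.instance Definition _ := Choice.on tensor.

Let cls (s : seq (A * F)) : tensor := \pi_({eq_quot tensor_equiv}) s.
Let rep (u : tensor) : seq (A * F) := repr (u : {eq_quot tensor_equiv}).

Let clsP s s' : cls s = cls s' <->
  forall (G : zmodType) (g : A -> F -> G), balanced g -> ev g s = ev g s'.
Proof.
split; first by move/eqquotP => /asboolP.
by move=> h; apply/eqquotP/asboolP.
Qed.

Let repK u : cls (rep u) = u.
Proof. exact: reprK. Qed.

Let ev_rep (G : zmodType) (g : A -> F -> G) s :
  balanced g -> ev g (rep (cls s)) = ev g s.
Proof. by move=> hg; apply: (iffLR (clsP _ _)) => //; rewrite repK. Qed.

Let tadd (u v : tensor) : tensor := cls (rep u ++ rep v).
Let topp (u : tensor) : tensor := cls [seq (- p.1, p.2) | p <- rep u].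

Let ev_cat (G : zmodType) (g : A -> F -> G) s s' :
  ev g (s ++ s') = ev g s + ev g s'.
Proof. by rewrite /ev big_cat. Qed.

Let balN (G : zmodType) (g : A -> F -> G) a x :
  balanced g -> g (- a) x = - g a x.
Proof.
case=> gD _ _; have g0 : g 0 x = 0.
  by apply: (@addrI _ (g 0 x)); rewrite -gD !addr0.
by apply/eqP; rewrite -addr_eq0 -gD addNr g0.
Qed.

Let ev_opp (G : zmodType) (g : A -> F -> G) s : balanced g ->
  ev g [seq (- p.1, p.2) | p <- s] = - ev g s.
Proof.
move=> hg; rewrite /ev big_map -sumrN; apply: eq_bigr => p _ /=.
exact: balN.
Qed.

Let taddA : associative tadd.
Proof.
move=> u v w; apply/clsP => G g hg.
by rewrite !ev_cat !ev_rep // !ev_cat addrA.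
Qed.

Let taddC : commutative tadd.
Proof. by move=> u v; apply/clsP => G g hg; rewrite !ev_cat addrC. Qed.

Let tadd0 : left_id (cls [::]) tadd.
Proof.
move=> u; rewrite -[RHS]repK; apply/clsP => G g hg.
by rewrite ev_cat ev_rep // {1}/ev big_nil add0r.
Qed.

Let taddN : left_inverse (cls [::]) topp tadd.
Proof.
move=> u; apply/clsP => G g hg.
by rewrite ev_cat ev_rep // ev_opp // addNr /ev big_nil.
Qed.

HB.instance Definition _ :=
  GRing.isZmodule.Build tensor taddA taddC tadd0 taddN.

Let tmap (a : A) (x : F) : tensor := cls [:: (a, x)].

Let clsD s s' : cls (s ++ s') = cls s + cls s'.
Proof. by apply/clsP => G g hg; rewrite !ev_cat !ev_rep. Qed.

Let ev1 (G : zmodType) (g : A -> F -> G) a x : ev g [:: (a, x)] = g a x.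
Proof. by rewrite /ev big_seq1. Qed.

Let tmap_balanced : balanced tmap.
Proof.
split=> [a a' x|a x x'|a r x].
- by rewrite -clsD; apply/clsP => G g [gD _ _]; rewrite ev_cat !ev1.
- by rewrite -clsD; apply/clsP => G g [_ gD _]; rewrite ev_cat !ev1.
- by apply/clsP => G g [_ _ gZ]; rewrite !ev1.
Qed.

Let cls_sum s : cls s = \sum_(p <- s) tmap p.1 p.2.
Proof.
elim: s => [|[a x] s IHs]; first by rewrite big_nil.
by rewrite big_cons -IHs -cat1s clsD.
Qed.

Lemma tensor_exists :
  exists (T : zmodType) (t : A -> F -> T), is_tensor t.
Proof.
exists tensor, tmap; split; first exact: tmap_balanced.
move=> G g hg; split.
- pose h (u : tensor) : G := ev g (rep u).
  have hB : {morph h : u v / u - v}.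
    by move=> u v; rewrite /h ev_rep // ev_cat ev_rep // ev_opp.
  pose hM := GRing.isZmodMorphism.Build _ _ h hB.
  pose H : {additive tensor -> G} := HB.pack h hM.
  by exists H => a x; rewrite /= /h ev_rep // ev1.
- move=> h h' hE hE' u; rewrite -[u]repK cls_sum !raddf_sum.
  by apply: eq_bigr => p _; rewrite hE hE'.
Qed.

End TensorExistence.

Section Complexes.
Variable R : pzRingType.

Record complex := Complex {
  obj :> int -> lmodType R;
  diff : forall m : int, {linear obj m -> obj (m - 1)};
  diff_diff : forall m (x : obj m), diff (m - 1) (diff m x) = 0
}.

Record chain_map (X Y : complex) := ChainMap {
  cmap :> forall m : int, {linear X m -> Y m};
  cmap_diff : forall m (x : X m), cmap (m - 1) (diff X m x) = diff Y m (cmap m x)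
}.

Definition exact_complex (X : complex) : Prop :=
  forall m (x : X (m - 1)), diff X (m - 1) x = 0 -> exists y, diff X m y = x.

Definition short_exact (X Y Z : complex) (i : chain_map X Y)
    (p : chain_map Y Z) : Prop :=
  forall m, [/\ injective (i m),
                forall z, exists y, p m y = z
              & forall y, p m y = 0 <-> exists x, i m x = y].

Record extension (X Y : complex) := Extension {
  ext_mid : complex;
  ext_in : chain_map Y ext_mid;
  ext_out : chain_map ext_mid X;
  ext_exact : short_exact ext_in ext_out
}.

Definition ext_equiv (X Y : complex) (E E' : extension X Y) : Prop :=
  exists h : chain_map (ext_mid E) (ext_mid E'),
    forall m, (forall y, h m (ext_in E m y) = ext_in E' m y) /\
              (forall e, ext_out E' m (h m e) = ext_out E m e).

Section SplitExtension.
Variables X Y : complex.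

Definition dsum_obj (m : int) : lmodType R := (Y m * X m)%type.

Definition dsum_diff_fun (m : int) (u : dsum_obj m) : dsum_obj (m - 1) :=
  (diff Y m u.1, diff X m u.2).

Lemma dsum_diff_linear m : linear (@dsum_diff_fun m).
Proof. by move=> r u v; rewrite /dsum_diff_fun /= !linearP. Qed.

HB.instance Definition _ m :=
  GRing.isLinear.Build R (dsum_obj m) (dsum_obj (m - 1)) _ (@dsum_diff_fun m)
    (@dsum_diff_linear m).

Lemma dsum_diff_diff m (u : dsum_obj m) :
  dsum_diff_fun (dsum_diff_fun u) = 0.
Proof. by rewrite /dsum_diff_fun /= !diff_diff. Qed.

Definition dsum : complex :=
  @Complex dsum_obj (fun m => @dsum_diff_fun m) dsum_diff_diff.

Definition dsum_in_fun (m : int) (y : Y m) : dsum_obj m := (y, 0).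

Lemma dsum_in_linear m : linear (@dsum_in_fun m).
Proof.
by move=> r u v; congr pair; rewrite /= scaler0 addr0.
Qed.

HB.instance Definition _ m :=
  GRing.isLinear.Build R (Y m) (dsum_obj m) _ (@dsum_in_fun m)
    (@dsum_in_linear m).

Definition dsum_out_fun (m : int) (u : dsum_obj m) : X m := u.2.

Lemma dsum_out_linear m : linear (@dsum_out_fun m).
Proof. by []. Qed.

HB.instance Definition _ m :=
  GRing.isLinear.Build R (dsum_obj m) (X m) _ (@dsum_out_fun m)
    (@dsum_out_linear m).

Lemma dsum_in_diff m (y : Y m) :
  dsum_in_fun (diff Y m y) = diff dsum m (dsum_in_fun y).
Proof. by rewrite /= /dsum_in_fun /dsum_diff_fun /= linear0. Qed.

Lemma dsum_out_diff m (u : dsum m) :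
  dsum_out_fun (diff dsum m u) = diff X m (dsum_out_fun u).
Proof. by []. Qed.

Definition dsum_in : chain_map Y dsum :=
  @ChainMap Y dsum (fun m => @dsum_in_fun m) dsum_in_diff.

Definition dsum_out : chain_map dsum X :=
  @ChainMap dsum X (fun m => @dsum_out_fun m) dsum_out_diff.

Lemma dsum_short_exact : short_exact dsum_in dsum_out.
Proof.
move=> m; split=> [y y' [] //|z|[y x]]; first by exists (0, z).
split=> [/= x0|[y' [_ <-]] //]; exists y.
by rewrite /= /dsum_in_fun -x0.
Qed.

Definition split_extension : extension X Y := Extension dsum_short_exact.

End SplitExtension.

(* Ext^1(X, Y) = 0, where Ext^1(X, Y) is the group of equivalence classes of
   extensions 0 -> Y -> E -> X -> 0 under the Baer sum, whose zero is the class
   of the split extension. *)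
Definition Ext1_zero (X Y : complex) : Prop :=
  forall E : extension X Y, ext_equiv E (split_extension X Y).

Definition complex_class := complex -> Prop.

Definition right_orth (C : complex_class) : complex_class :=
  fun Z => forall X, C X -> Ext1_zero X Z.

Definition left_orth (C : complex_class) : complex_class :=
  fun Z => forall X, C X -> Ext1_zero Z X.

Definition cotorsion_pair (C D : complex_class) : Prop :=
  (forall Z, C Z <-> left_orth D Z) /\ (forall Z, D Z <-> right_orth C Z).

Definition complete_cotorsion_pair (C D : complex_class) : Prop :=
  cotorsion_pair C D /\
  forall Z : complex,
    (exists (A B : complex) (i : chain_map B A) (p : chain_map A Z),
       [/\ C A, D B & short_exact i p]) /\
    (exists (A B : complex) (i : chain_map Z B) (p : chain_map B A),
       [/\ C A, D B & short_exact i p]).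

Definition dw_flat (n : nat) : complex_class :=
  fun X => forall m, flat_dim_le n (X m).

Definition ex_flat (n : nat) : complex_class :=
  fun X => dw_flat n X /\ exact_complex X.

End Complexes.

(* Main.v *)
Require Import Defs.
From HB Require Import structures.
From mathcomp Require Import all_boot all_algebra.
From mathcomp Require Import boolp functions.
From mathcomp Require classical_sets.

Set Implicit Arguments.
Unset Strict Implicit.
Unset Printing Implicit Defensive.

Import GRing.Theory Num.Theory.
Local Open Scope ring_scope.
Local Open Scope quotient_scope.

(* For a module M, flat dimension at most n means that Tor_(n+1)(-, M)
   vanishes, i.e. that balanced maps K x M -> QZ extend to P x M -> QZ for every
   n-th syzygy K -> P of right modules. This condition passes to pure submodules
   and pure quotients, and it is the vanishing of Ext^1(M, Y) for suitable
   character modules Y. Two consequences for the class C of complexes at hand: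
   - C is the left orthogonal of its right orthogonal: test against products of
     disk complexes on these Y (and, for exactness, against complexes with zero
     differential on an injective cogenerator);
   - every element of X in C lies in a "small" subcomplex that is pure in each
     degree, is exact if X is, and is a quotient of one fixed free complex P.
     Such subcomplexes and their quotients stay in C, so by Zorn's lemma (as in
     Eklof's lemma) Y is in the right orthogonal of C as soon as maps K -> Y
     extend to P for all K with P / K in C.
   For every Z, the complexes under Z with chosen solutions to these extension
   problems form a category of algebras with an initial object B. Initiality
   gives Z -> B the left lifting property against epimorphisms with kernel in
   the right orthogonal, so B / Z is in C and B in its right orthogonal; the
   other approximation sequence follows by Salce's pushout. *)

(** Tensor products occur only in the comparison [flat_lflat]. As [QZ] is an injective cogenerator,
    injectivity of [A (x) M -> B (x) M] means that balanced maps into [QZ] extend, and the snake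
    lemma, dimension shifting and purity are all carried out on such maps. No cardinals or ordinals
    occur either. Small means being an image of one complex [P], free on a type of names that does
    not depend on the ambient complex, and transfinite iteration becomes recursion on well-founded
    terms. Free modules, free complexes and the initial algebra come from one device: terms are
    identified when all interpretations agree on them. A law then holds because it holds in every
    model, and evaluation respects the identification by definition. A class enters the main
    argument only through three properties: it passes to good subcomplexes and to good quotients,
    and it contains its double orthogonal. This lets one theorem serve both classes. *)

Definition lin_of (R : pzRingType) (U V : lmodType R) (f : U -> V)
    (fL : linear f) : {linear U -> V} :=
  HB.pack f (GRing.isLinear.Build R U V _ f fL).

Definition add_of (U V : zmodType) (f : U -> V)
    (fB : {morph f : x y / x - y}) : {additive U -> V} :=
  HB.pack f (GRing.isZmodMorphism.Build U V f fB).

Lemma linP (R : pzRingType) (U V : lmodType R) (f : U -> V) :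
  (forall x y, f (x + y) = f x + f y) ->
  (forall r x, f (r *: x) = r *: f x) -> linear f.
Proof. by move=> fD fZ r x y; rewrite fD fZ. Qed.

(** * Modules presented by a setoid *)

(** The carrier is a bare type and the laws hold up to [pm_eq], so that terms, subsets and maps can
    serve as elements; the quotient below obtains the choice structure of an [lmodType] from
    [{classic p}]. The opposite of x is its multiple by -1. *)
Record premod (R : pzRingType) := Premod {
  pm_sort :> Type;
  pm_zero : pm_sort;
  pm_add : pm_sort -> pm_sort -> pm_sort;
  pm_scale : R -> pm_sort -> pm_sort;
  pm_eq : pm_sort -> pm_sort -> Prop;
  pm_refl : forall x, pm_eq x x;
  pm_sym : forall x y, pm_eq x y -> pm_eq y x;
  pm_trans : forall x y z, pm_eq x y -> pm_eq y z -> pm_eq x z;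
  pm_eqD : forall x x' y y',
    pm_eq x x' -> pm_eq y y' -> pm_eq (pm_add x y) (pm_add x' y');
  pm_eqZ : forall r x x', pm_eq x x' -> pm_eq (pm_scale r x) (pm_scale r x');
  pm_addA : forall x y z,
    pm_eq (pm_add x (pm_add y z)) (pm_add (pm_add x y) z);
  pm_addC : forall x y, pm_eq (pm_add x y) (pm_add y x);
  pm_add0 : forall x, pm_eq (pm_add pm_zero x) x;
  pm_addN : forall x, pm_eq (pm_add (pm_scale (-1) x) x) pm_zero;
  pm_scaleA : forall r s x,
    pm_eq (pm_scale r (pm_scale s x)) (pm_scale (r * s) x);
  pm_scale1 : forall x, pm_eq (pm_scale 1 x) x;
  pm_scaleDr : forall r x y,
    pm_eq (pm_scale r (pm_add x y)) (pm_add (pm_scale r x) (pm_scale r y));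
  pm_scaleDl : forall r s x,
    pm_eq (pm_scale (r + s) x) (pm_add (pm_scale r x) (pm_scale s x))
}.

Section Qmod.
Variables (R : pzRingType) (p : premod R).

Let rel (x y : {classic p}) : bool := `[< pm_eq (x : p) (y : p) >].

Let rel_refl : reflexive rel.
Proof. by move=> x; apply/asboolP/pm_refl. Qed.

Let rel_sym : symmetric rel.
Proof. by move=> x y; apply/asboolP/asboolP; apply: pm_sym. Qed.

Let rel_trans : transitive rel.
Proof.
by move=> y x z /asboolP h /asboolP h'; apply/asboolP; apply: pm_trans h h'.
Qed.

Let rel_equiv := EquivRel rel rel_refl rel_sym rel_trans.

Definition qmod_sort : Type := {eq_quot rel_equiv}.
HB.instance Definition _ := Choice.on qmod_sort.

Definition qcls (x : p) : qmod_sort := \pi_({eq_quot rel_equiv}) (x : {classic p}).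
Definition qrep (u : qmod_sort) : p := repr (u : {eq_quot rel_equiv}).

Lemma qrepK u : qcls (qrep u) = u.
Proof. exact: reprK. Qed.

Lemma qclsP x y : qcls x = qcls y <-> pm_eq x y.
Proof.
split; first by move/eqquotP => /asboolP.
by move=> h; apply/eqquotP/asboolP.
Qed.

Lemma qrep_cls x : pm_eq (qrep (qcls x)) x.
Proof. by apply/qclsP; rewrite qrepK. Qed.

Let qadd u v := qcls (pm_add (qrep u) (qrep v)).
Let qscale r u := qcls (pm_scale r (qrep u)).
Let qopp u := qscale (-1) u.

Let clsD x y : qcls (pm_add x y) = qadd (qcls x) (qcls y).
Proof. by apply/qclsP/pm_eqD; apply/pm_sym/qrep_cls. Qed.

Let clsZ r x : qcls (pm_scale r x) = qscale r (qcls x).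
Proof. by apply/qclsP/pm_eqZ; apply/pm_sym/qrep_cls. Qed.

Let qaddA : associative qadd.
Proof.
move=> u v w; rewrite -[u]qrepK -[v]qrepK -[w]qrepK -!clsD.
exact/qclsP/pm_addA.
Qed.

Let qaddC : commutative qadd.
Proof. by move=> u v; apply/qclsP/pm_addC. Qed.

Let qadd0 : left_id (qcls (pm_zero p)) qadd.
Proof. by move=> u; rewrite -[u]qrepK -clsD; apply/qclsP/pm_add0. Qed.

Let qaddN : left_inverse (qcls (pm_zero p)) qopp qadd.
Proof.
by move=> u; rewrite -[u]qrepK /qopp -clsZ -clsD; apply/qclsP/pm_addN.
Qed.

HB.instance Definition _ :=
  GRing.isZmodule.Build qmod_sort qaddA qaddC qadd0 qaddN.

Let qscaleA r s u : qscale r (qscale s u) = qscale (r * s) u.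
Proof. by rewrite -[u]qrepK -!clsZ; apply/qclsP/pm_scaleA. Qed.

Let qscale1 : left_id 1 qscale.
Proof. by move=> u; rewrite -[u]qrepK -clsZ; apply/qclsP/pm_scale1. Qed.

Let qscaleDr : right_distributive qscale +%R.
Proof.
move=> r u v; rewrite -[u]qrepK -[v]qrepK -[_ + _]clsD -!clsZ.
by rewrite -[RHS]clsD; apply/qclsP/pm_scaleDr.
Qed.

Let qscaleDl u : {morph qscale^~ u : r s / r + s}.
Proof.
move=> r s; rewrite -[u]qrepK -!clsZ -[RHS]clsD; exact/qclsP/pm_scaleDl.
Qed.

HB.instance Definition _ :=
  GRing.Zmodule_isLmodule.Build R qmod_sort qscaleA qscale1 qscaleDr qscaleDl.

Definition qmod : lmodType R := qmod_sort.
Definition qpi (x : p) : qmod := qcls x.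
Definition qsec (u : qmod) : p := qrep u.

Lemma qsecK u : qpi (qsec u) = u. Proof. exact: qrepK. Qed.
Lemma qpiP x y : qpi x = qpi y <-> pm_eq x y. Proof. exact: qclsP. Qed.
Lemma qpi0 : qpi (pm_zero p) = 0. Proof. by []. Qed.
Lemma qpiD x y : qpi (pm_add x y) = qpi x + qpi y. Proof. exact: clsD. Qed.
Lemma qpiZ r x : qpi (pm_scale r x) = r *: qpi x. Proof. exact: clsZ. Qed.
Lemma qsec_pi x : pm_eq (qsec (qpi x)) x. Proof. exact: qrep_cls. Qed.

End Qmod.

(** * Zorn's lemma and divisible groups *)

Lemma zorn_above (T : Type) (P : (T -> Prop) -> Prop) (A0 : T -> Prop) :
  P A0 ->
  (forall F : (T -> Prop) -> Prop,
     (exists A, F A) -> (forall A, F A -> P A) ->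
     (forall A B, F A -> F B ->
        (forall x, A x -> B x) \/ (forall x, B x -> A x)) ->
     P (fun x => exists2 A, F A & A x)) ->
  exists A, [/\ P A, forall x, A0 x -> A x &
    forall B, P B -> (forall x, A x -> B x) -> forall x, B x -> A x].
Proof.
move=> PA0 Pchain.
(* Enlarging every set by [A0] keeps the maximal set above [A0] and makes the empty chain
   harmless. *)
pose P' (A : T -> Prop) := P (fun x => A x \/ A0 x).
have [F FP Ftot|A [PA Amax]] := @classical_sets.Zorn_bigcup T P'.
  have [[A FA]|F0] := pselect (exists A, F A); last first.
    rewrite /P'; set B := (fun x => _); suff -> : B = A0 by [].
    apply: funext => x; apply: propext; split; last by right.
    by case=> // -[A FA]; case: F0; exists A.
  pose F' (B : T -> Prop) := exists2 A, F A & B = (fun x => A x \/ A0 x).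
  rewrite /P'; set B := (fun x => _).
  have -> : B = (fun x => exists2 A, F' A & A x).
    apply: funext => x; apply: propext; split.
      case=> [[A' FA' A'x]|A0x].
        by exists (fun x => A' x \/ A0 x); [exists A'|left].
      by exists (fun x => A x \/ A0 x); [exists A|right].
    by case=> C [A' FA' ->] [A'x|A0x]; [left; exists A'|right].
  apply: Pchain.
  - by eexists; exists A.
  - by move=> _ [A' FA' ->]; apply: FP.
  - move=> _ _ [A1 F1 ->] [A2 F2 ->].
    by case: (Ftot _ _ F1 F2) => s; [left|right] => x [/s|]; by [left|right].
exists (fun x => A x \/ A0 x); split=> //; first by right.
move=> B PB AB x Bx; apply: contrapT => nAx.
apply: (Amax B).
  split; last by move=> /(_ x Bx) Ax; apply: nAx; left.
  by move=> y Ay; apply: AB; left.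
rewrite /P'; set C := (fun x => _); suff -> : C = B by [].
apply: funext => y; apply: propext; split=> [[]//|]; last by left.
by move=> A0y; apply: AB; right.
Qed.

(** Injectivity as an abelian group. The map to be extended is a total function whose values off U
    are ignored, which avoids making U a type. *)
Definition extends_additive (D : zmodType) : Prop :=
  forall (V : zmodType) (U : V -> Prop) (f : V -> D),
    U 0 -> (forall x y, U x -> U y -> U (x - y)) ->
    (forall x y, U x -> U y -> f (x - y) = f x - f y) ->
  exists g : {additive V -> D}, forall x, U x -> g x = f x.

Definition cogenerator (D : zmodType) : Prop :=
  forall (V : zmodType) (v : V), v <> 0 ->
  exists g : {additive V -> D}, g v <> 0.

Section Divisible.
Variables (V D : zmodType).
Hypothesis divD : forall (d : D) k, (0 < k)%N -> exists e : D, e *+ k = d.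

(* Partial additive maps are represented by their graphs. *)
Let graph (G : V * D -> Prop) : Prop :=
  [/\ G 0, forall a b, G a -> G b -> G (a - b) & forall d, G (0, d) -> d = 0].

Let graphMz G a z : graph G -> G a -> G (a *~ z).
Proof.
case=> G0 GB _ Ga.
have GN b : G b -> G (- b) by move=> Gb; rewrite -sub0r; apply: GB.
have GD b c : G b -> G c -> G (b + c).
  by move=> Gb Gc; rewrite -[c]opprK; apply: GB => //; apply: GN.
have Gn n : G (a *+ n).
  by elim: n => [|n IHn]; rewrite ?mulr0n // mulrS; apply: GD.
by case: z => n; rewrite ?NegzE ?mulrNz -pmulrn; [|apply: GN]; apply: Gn.
Qed.

Let pairMz (a : V) (b : D) z : (a, b) *~ z = (a *~ z, b *~ z).
Proof.
have e n : (a, b) *+ n = (a *+ n, b *+ n).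
  by elim: n => [|n IHn]; rewrite ?mulr0n // !mulrS IHn.
by case: z => n; rewrite ?NegzE ?mulrNz -!pmulrn e.
Qed.

(** The new graph is G + Z(v, e); it stays single-valued because e agrees with G on every multiple
    of v in the domain. *)
Let step G v e : graph G -> (forall z d, G (v *~ z, d) -> d = e *~ z) ->
  graph (fun a => exists z, G (a - (v, e) *~ z)).
Proof.
case=> G0 GB Gf h; split.
- by exists 0; rewrite mulr0z subr0.
- move=> a b [z Ga] [y Gb]; exists (z - y).
  rewrite mulrzBr.
  have -> : a - b - ((v, e) *~ z - (v, e) *~ y) =
            a - (v, e) *~ z - (b - (v, e) *~ y).
    by rewrite opprD addrACA -opprD.
  exact: GB.
- move=> d [z]; rewrite pairMz => Gz.
  have := @h (- z) (d - e *~ z).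
  have -> : (v *~ (- z), d - e *~ z) = (0, d) - (v *~ z, e *~ z).
    by rewrite mulrNz; congr pair; rewrite /= sub0r.
  move=> /(_ Gz)/eqP.
  by rewrite mulrNz subr_eq addNr => /eqP.
Qed.

(** The z with v *~ z in the domain form a subgroup kZ. If k = 0 the value e = 0 will do; otherwise
    e is a k-th part of the value at v *+ k, and minimality of k forces every such z to have
    remainder 0. *)
Let stepE G v : graph G ->
  exists e, forall z d, G (v *~ z, d) -> d = e *~ z.
Proof.
move=> gG; have [G0 GB Gf] := gG.
have Gfun a d d' : G (a, d) -> G (a, d') -> d = d'.
  move=> /GB h /h; rewrite -[X in G X]/(a - a, d - d') subrr.
  by move=> /Gf /eqP; rewrite subr_eq0 => /eqP.
pose T n := (0 < n)%N && `[< exists d, G (v *+ n, d) >].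
have [exT|noT] := pselect (exists n, T n); last first.
  exists 0 => z d Gz; rewrite mul0rz.
  have : `|z|%N = 0%N.
    apply/eqP; rewrite -leqn0 leqNgt; apply/negP => z0; apply: noT.
    exists `|z|%N; rewrite /T z0; apply/asboolP.
    case: (intP z) Gz => [|n|n] Gz.
    - by exists d; rewrite mulr0n; rewrite mulr0z in Gz.
    - by exists d; rewrite absz_nat pmulrn.
    - exists (- d); rewrite abszN absz_nat pmulrn.
      have := graphMz (-1) gG Gz.
      by rewrite pairMz -mulrzA !mulrN1 opprK mulrN1z.
  by move=> /eqP; rewrite absz_eq0 => /eqP z0; move: Gz; rewrite z0 mulr0z => /Gf.
case: (ex_minnP exT) => k /andP[k0 /asboolP[dk Gk]] kmin.
have [e ek] := divD dk k0.
exists e => z d Gz.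
have [q zq] : exists q, z = k%:Z * q.
  suff : (z %% k%:Z)%Z = 0.
    by move=> z0; exists (z %/ k%:Z)%Z; rewrite {1}(divz_eq z k) z0 addr0 mulrC.
  have zk0 : 0 <= (z %% k%:Z)%Z by apply: modz_ge0; rewrite eqz_nat -lt0n.
  have zk : (z %% k%:Z)%Z < k by apply: ltz_pmod; rewrite ltz_nat.
  case E: (z %% k%:Z)%Z zk0 zk => [[|r]|//] // _; rewrite ltz_nat => rk.
  have : (k <= r.+1)%N.
    apply: kmin; apply/andP; split=> //; apply/asboolP.
    exists (d - dk *~ (z %/ k)%Z).
    have -> : (v *+ r.+1, d - dk *~ (z %/ k)%Z) =
        (v *~ z, d) - (v *+ k, dk) *~ (z %/ k)%Z.
      rewrite pairMz; congr pair; rewrite /=.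
      by rewrite pmulrn -E /modz mulrzBr pmulrn -mulrzA [k%:Z * _]mulrC.
    by apply: GB => //; apply: graphMz.
  by rewrite leqNgt rk.
apply: Gfun Gz _; rewrite zq !mulrzA -!pmulrn ek -pairMz.
exact: graphMz.
Qed.

Lemma graph_extend G : graph G ->
  exists g : {additive V -> D}, forall a, G a -> g a.1 = a.2.
Proof.
move=> gG.
have [F [A FA] FP Ftot|H [gH GH Hmax]] := zorn_above gG.
  split.
  - by exists A => //; case: (FP _ FA).
  - move=> a b [A1 F1 A1a] [A2 F2 A2b].
    have [s|s] := Ftot _ _ F1 F2.
      by exists A2 => //; case: (FP _ F2) => _ + _; apply=> //; apply: s.
    by exists A1 => //; case: (FP _ F1) => _ + _; apply=> //; apply: s.
  - by move=> d [A1 F1 /=]; case: (FP _ F1) => _ _; apply.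
have [H0 HB Hf] := gH.
have tot v : exists d, H (v, d).
  have [e he] := stepE v gH; exists e.
  apply: (Hmax _ (step gH he)).
    by move=> a Ha; exists 0; rewrite mulr0z subr0.
  by exists 1; rewrite mulr1z subrr.
have [g gP] := choice tot.
have Hfun a d d' : H (a, d) -> H (a, d') -> d = d'.
  move=> /HB h /h; rewrite -[X in H X]/(a - a, d - d') subrr.
  by move=> /Hf /eqP; rewrite subr_eq0 => /eqP.
have gB : {morph g : x y / x - y}.
  by move=> x y; apply: Hfun (gP _) _; apply: (HB (_, _) (_, _)).
exists (add_of gB) => -[a d] /GH Ha /=; exact: Hfun (gP a) Ha.
Qed.

Lemma divisible_extends (U : V -> Prop) (f : V -> D) :
    U 0 -> (forall x y, U x -> U y -> U (x - y)) ->
    (forall x y, U x -> U y -> f (x - y) = f x - f y) ->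
  exists g : {additive V -> D}, forall x, U x -> g x = f x.
Proof.
move=> U0 UB fB.
have f0 : f 0 = 0 by rewrite -[in LHS](subrr 0) fB // subrr.
have [|g gP] := @graph_extend (fun a => U a.1 /\ a.2 = f a.1).
  split=> [//|[a d] [b e] [/= Ua ->] [/= Ub ->]|d [_ /= ->] //].
  by split; [apply: UB|rewrite fB].
by exists g => x Ux; apply: (gP (x, f x)).
Qed.

Hypothesis torsionD : forall k, (1 < k)%N -> exists2 d : D, d <> 0 & d *+ k = 0.

(** A nonzero e killed by every integer that kills v makes Z(v, e) the graph of a map that is
    nonzero at v, and this map extends. *)
Lemma divisible_cogenerates (v : V) : v <> 0 ->
  exists g : {additive V -> D}, g v <> 0.
Proof.
move=> v0.
have [e e0 he] : exists2 e : D, e <> 0 & forall z, v *~ z = 0 -> e *~ z = 0.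
  pose T n := (0 < n)%N && (v *+ n == 0).
  have [exT|noT] := pselect (exists n, T n); last first.
    (* Here v has infinite order, so any nonzero e will do; one of order 2 is at hand. *)
    have [e e0 _] := torsionD (ltnSn 1); exists e => // z vz.
    case: (intP z) vz => [|n|n] vz; first by rewrite mulr0z.
      by case: noT; exists n.+1; rewrite /T pmulrn vz eqxx.
    case: noT; exists n.+1; rewrite /T pmulrn /= -oppr_eq0.
    by rewrite -mulrNz vz.
  case: (ex_minnP exT) => k /andP[k0 /eqP kv] kmin.
  have k1 : (1 < k)%N.
    rewrite ltn_neqAle k0 andbT; apply/eqP => k1; apply: v0.
    by rewrite -kv -k1.
  have [e e0 ek] := torsionD k1; exists e => // z vz.
  suff z0 : (z %% k%:Z)%Z = 0.
    by rewrite (divz_eq z k) z0 addr0 mulrC mulrzA -pmulrn ek mul0rz.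
  have zk0 : 0 <= (z %% k%:Z)%Z by apply: modz_ge0; rewrite eqz_nat -lt0n.
  have zk : (z %% k%:Z)%Z < k by apply: ltz_pmod; rewrite ltz_nat.
  case E: (z %% k%:Z)%Z zk0 zk => [[|r]|//] // _; rewrite ltz_nat => rk.
  have : (k <= r.+1)%N.
    apply: kmin; rewrite /T /= pmulrn -E /modz mulrzBr vz sub0r oppr_eq0.
    by rewrite mulrC mulrzA -pmulrn kv mul0rz.
  by rewrite leqNgt rk.
have g0 : graph (fun a => a = 0).
  by split=> [//|a b -> ->|d [] //]; rewrite subrr.
have [|g gP] := graph_extend (@step _ v e g0 _).
  by move=> z d [vz ->]; rewrite he.
exists g; have := gP (v, e) => /= ->; first by [].
by exists 1; rewrite mulr1z subrr.
Qed.

End Divisible.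

Section QmodZ.

Let int_of (q : rat) : Prop := exists z : int, q = z%:~R.

Let int_ofD p q : int_of p -> int_of q -> int_of (p + q).
Proof. by move=> [y ->] [z ->]; exists (y + z); rewrite rmorphD. Qed.

Let int_ofM (y : int) q : int_of q -> int_of (y%:~R * q).
Proof. by move=> [z ->]; exists (y * z); rewrite rmorphM. Qed.

Let int_ofN q : int_of q -> int_of (- q).
Proof. by move=> [z ->]; exists (- z); rewrite rmorphN. Qed.

Let cong_of (p q : rat) (e : p = q) : int_of (p - q).
Proof. by rewrite e subrr; exists 0. Qed.

Definition QZ_premod : premod int.
Proof.
refine (@Premod int rat 0 +%R (fun z q => z%:~R * q)
  (fun p q => int_of (p - q)) _ _ _ _ _ _ _ _ _ _ _ _ _).
- by move=> x; apply: cong_of.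
- by move=> x y h; rewrite -opprB; apply: int_ofN.
- by move=> x y z h h'; rewrite -(subrKA y); apply: int_ofD.
- by move=> x x' y y' h h'; rewrite opprD addrACA; apply: int_ofD.
- by move=> r x x' h; rewrite -mulrBr; apply: int_ofM.
- by move=> x y z; apply: cong_of; rewrite addrA.
- by move=> x y; apply: cong_of; rewrite addrC.
- by move=> x; apply: cong_of; rewrite add0r.
- by move=> x; apply: cong_of; rewrite mulrN1z mulN1r addNr.
- by move=> r s x; apply: cong_of; rewrite mulrA rmorphM.
- by move=> x; apply: cong_of; rewrite mul1r.
- by move=> r x y; apply: cong_of; rewrite mulrDr.
- by move=> r s x; apply: cong_of; rewrite rmorphD mulrDl.
Defined.

Let piMn (q : rat) k : @qpi _ QZ_premod q *+ k = qpi (q *+ k : QZ_premod).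
Proof.
elim: k => [|k IHk]; first by rewrite !mulr0n.
by rewrite !mulrS IHk -qpiD.
Qed.

Lemma injective_cogenerator :
  exists D : zmodType, extends_additive D /\ cogenerator D.
Proof.
exists (qmod QZ_premod).
have div (d : qmod QZ_premod) k : (0 < k)%N -> exists e, e *+ k = d.
  move=> k0; exists (qpi ((qsec d : rat) / k%:R : QZ_premod)).
  rewrite piMn -[in RHS](qsecK d); congr qpi.
  have k0' : k%:R != 0 :> rat by rewrite pnatr_eq0 -lt0n.
  exact: (etrans (esym (mulr_natr _ _)) (divfK k0' (qsec d : rat))).
split; first by move=> V U f; apply: divisible_extends.
move=> V v; apply: divisible_cogenerates => // k k1.
have k0 : k%:R != 0 :> rat by rewrite pnatr_eq0 -lt0n (ltn_trans _ k1).
exists (qpi (k%:R^-1 : QZ_premod)); last first.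
  rewrite piMn -qpi0; apply/qpiP; exists 1.
  have e : k%:R^-1 *+ k = 1 :> rat by rewrite -[LHS]mulr_natr mulVf.
  by rewrite /= subr0 e.
rewrite -qpi0 => /qpiP[z] /=; rewrite subr0 => zk.
have : (1 : rat) = (k%:Z * z)%:~R by rewrite rmorphM /= -zk mulfV.
move=> /(@intr_inj rat 1) kz.
have : (k %| 1)%Z by apply/dvdzP; exists z; rewrite mulrC.
by rewrite dvdz1 absz_nat => /eqP k1'; rewrite k1' in k1.
Qed.

End QmodZ.

(** Of the rationals modulo the integers, only injectivity and cogeneration are retained. *)
Definition QZ : zmodType := sval (cid injective_cogenerator).

Lemma QZ_extends : extends_additive QZ.
Proof. by rewrite /QZ; case: cid => D []. Qed.

Lemma QZ_cogenerator : cogenerator QZ.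
Proof. by rewrite /QZ; case: cid => D []. Qed.

Lemma additive_extend_along (U V : zmodType) (i : {additive U -> V})
    (f : U -> QZ) : injective i -> {morph f : x y / x - y} ->
  exists g : {additive V -> QZ}, forall x, g (i x) = f x.
Proof.
move=> i_inj fB.
have [g0 g0P] : exists g0 : V -> QZ, forall x, g0 (i x) = f x.
  have h v : exists d, forall x, i x = v -> d = f x.
    have [[x <-]|n] := pselect (exists x, i x = v).
      by exists (f x) => y /i_inj ->.
    by exists 0 => x xv; case: n; exists x.
  by have [g0 g0P] := choice h; exists g0 => x; apply: g0P.
have [||_ _ [x <-] [y <-]|g gP] :=
    @QZ_extends V (fun v => exists x, i x = v) g0.
- by exists 0; rewrite raddf0.
- by move=> _ _ [x <-] [y <-]; exists (x - y); rewrite raddfB.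
- by rewrite -raddfB !g0P.
by exists g => x; rewrite gP ?g0P //; exists x.
Qed.

(** * Submodules, quotients, free and character modules *)

Section Interpretations.
Variables (R : pzRingType) (T : Type) (z : T) (add : T -> T -> T)
  (scale : R -> T -> T) (I : Type) (M : I -> lmodType R)
  (ev : forall A, T -> M A).
Hypotheses (ev0 : forall A, ev A z = 0)
  (evD : forall A x y, ev A (add x y) = ev A x + ev A y)
  (evZ : forall A r x, ev A (scale r x) = r *: ev A x).

(** Each law of the quotient holds because it holds in every [M A]. Free modules take all
    interpretations of the generators, submodules the single interpretation by inclusion. *)
Definition premod_of : premod R.
Proof.
refine (@Premod R T z add scale (fun x y => forall A, ev A x = ev A y)
  _ _ _ _ _ _ _ _ _ _ _ _ _) => //.
- by move=> x y z' h h' A; rewrite h.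
- by move=> x x' y y' h h' A; rewrite !evD h h'.
- by move=> r x x' h A; rewrite !evZ h.
- by move=> x y z' A; rewrite !evD addrA.
- by move=> x y A; rewrite !evD addrC.
- by move=> x A; rewrite !evD ev0 add0r.
- by move=> x A; rewrite !evD evZ ev0 scaleN1r addNr.
- by move=> r s x A; rewrite !evZ scalerA.
- by move=> x A; rewrite !evZ scale1r.
- by move=> r x y A; rewrite !(evZ, evD) scalerDr.
- by move=> r s x A; rewrite !(evZ, evD) scalerDl.
Defined.

End Interpretations.

Definition submodule (R : pzRingType) (M : lmodType R) (K : M -> Prop) : Prop :=
  K 0 /\ forall r x y, K x -> K y -> K (r *: x + y).

Section Submodule.
Variables (R : pzRingType) (M : lmodType R) (K : M -> Prop).
Hypothesis subK : submodule K.

Lemma submodule0 : K 0. Proof. by case: subK. Qed.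
Lemma submoduleD x y : K x -> K y -> K (x + y).
Proof. by case: subK => _ h Kx Ky; rewrite -[x]scale1r; apply: h. Qed.
Lemma submoduleZ r x : K x -> K (r *: x).
Proof. by case: subK => K0 h Kx; rewrite -[r *: x]addr0; apply: h. Qed.
Lemma submoduleB x y : K x -> K y -> K (x - y).
Proof.
by move=> Kx Ky; rewrite -scaleN1r; apply: submoduleD => //; apply: submoduleZ.
Qed.
Lemma submodule_exists : exists (N : lmodType R) (i : {linear N -> M}),
  injective i /\ forall x, K x <-> exists y, i y = x.
Proof.
pose ev (A : unit) (u : {x | K x}) : M := sval u.
pose p : premod R := @premod_of R {x | K x} (exist _ 0 submodule0)
  (fun u v => exist _ _ (submoduleD (svalP u) (svalP v)))
  (fun r u => exist _ _ (submoduleZ r (svalP u))) unit (fun=> M) ev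
  (fun=> erefl) (fun _ _ _ => erefl) (fun _ _ _ => erefl).
pose i (u : qmod p) : M := sval (qsec u).
have iL : linear i.
  apply: linP => [u v|r u]; rewrite /i.
    by have := qsec_pi (pm_add (qsec u) (qsec v)) tt; rewrite qpiD !qsecK.
  by have := qsec_pi (pm_scale r (qsec u)) tt; rewrite qpiZ !qsecK.
exists (qmod p), (lin_of iL); split=> [u v /= uv|x].
  by rewrite -[u]qsecK -[v]qsecK; apply/qpiP => A.
split=> [Kx|[u <-]]; last by apply: svalP.
exists (@qpi _ p (exist _ x Kx)).
exact: (@qsec_pi _ p (exist _ x Kx) tt).
Qed.

Let eqK x y : x = y -> K (x - y).
Proof. by move=> ->; rewrite subrr; apply: submodule0. Qed.

Definition quotient_premod : premod R.
Proof.
refine (@Premod R M 0 +%R *:%R (fun x y => K (x - y))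
  _ _ _ _ _ _ _ _ _ _ _ _ _).
- by move=> x; apply: eqK.
- by move=> x y /(submoduleZ (-1)); rewrite scaleN1r opprB.
- by move=> x y z h h'; rewrite -(subrKA y); apply: submoduleD.
- by move=> x x' y y' h h'; rewrite opprD addrACA; apply: submoduleD.
- by move=> r x x' h; rewrite -scalerBr; apply: submoduleZ.
- by move=> x y z; apply: eqK; rewrite addrA.
- by move=> x y; apply: eqK; rewrite addrC.
- by move=> x; apply: eqK; rewrite add0r.
- by move=> x; apply: eqK; rewrite scaleN1r addNr.
- by move=> r s x; apply: eqK; rewrite scalerA.
- by move=> x; apply: eqK; rewrite scale1r.
- by move=> r x y; apply: eqK; rewrite scalerDr.
- by move=> r s x; apply: eqK; rewrite scalerDl.
Defined.

Lemma quotient_exists : exists (L : lmodType R) (q : {linear M -> L}),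
  (forall y, exists x, q x = y) /\ forall x, q x = 0 <-> K x.
Proof.
pose p := quotient_premod.
have qL : linear (@qpi _ p).
  by apply: linP => [x y|r x]; rewrite -(qpiD, qpiZ).
exists (qmod p), (lin_of qL); split=> [y|x /=].
  by exists (qsec y); apply: qsecK.
rewrite -[X in _ = X <-> _]qpi0; split=> [/qpiP /=|Kx].
  by rewrite subr0.
by apply/qpiP; rewrite /= subr0.
Qed.

End Submodule.

Section Free.
Variables (S : pzRingType) (X : Type).

Inductive mterm : Type :=
  MGen of X | MZero | MAdd of mterm & mterm | MScale of S & mterm.

Record minterp := Minterp { mi_mod : lmodType S; mi_gen : X -> mi_mod }.

Fixpoint meval (A : minterp) (t : mterm) : mi_mod A :=
  match t with
  | MGen x => mi_gen A x
  | MZero => 0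
  | MAdd t u => meval A t + meval A u
  | MScale r t => r *: meval A t
  end.

Lemma free_exists : exists (F : lmodType S) (g : X -> F),
  (forall (N : lmodType S) (a : X -> N),
     exists h : {linear F -> N}, forall x, h (g x) = a x) /\
  (forall (N : lmodType S) (h h' : {linear F -> N}),
     (forall x, h (g x) = h' (g x)) -> h =1 h').
Proof.
pose p : premod S := @premod_of S mterm MZero MAdd MScale minterp mi_mod meval
  (fun=> erefl) (fun _ _ _ => erefl) (fun _ _ _ => erefl).
exists (qmod p), (fun x => @qpi _ p (MGen x)); split=> [N a|N h h' hE u].
  pose A := Minterp a.
  pose h (u : qmod p) : N := meval A (qsec u).
  have hL : linear h.
    apply: linP => [u v|r u]; rewrite /h.
      by have := qsec_pi (pm_add (qsec u) (qsec v)) A; rewrite qpiD !qsecK.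
    by have := qsec_pi (pm_scale r (qsec u)) A; rewrite qpiZ !qsecK.
  by exists (lin_of hL) => x; apply: (@qsec_pi _ p (MGen x) A).
rewrite -[u]qsecK; elim: (qsec u : mterm) => [x||t IHt t' IHt'|r t IHt].
- exact: hE.
- by rewrite -[qpi _]/(0 : qmod p) !raddf0.
- have e : @qpi _ p (MAdd t t') = @qpi _ p t + @qpi _ p t' := @qpiD _ p t t'.
  by rewrite e !linearD; congr (_ + _); [apply: IHt|apply: IHt'].
- have e : @qpi _ p (MScale r t) = r *: @qpi _ p t := @qpiZ _ p r t.
  by rewrite e !linearZ; congr (_ *: _); apply: IHt.
Qed.

End Free.

Section Character.
Variables (S : pzRingType) (T : zmodType) (act : S -> T -> T).
Hypotheses (actB : forall s, {morph act s : x y / x - y})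
  (act1 : forall x, act 1 x = x)
  (actM : forall r s x, act (r * s) x = act s (act r x))
  (actDl : forall r s x, act (r + s) x = act r x + act s x).

Let chr := {additive T -> QZ}.

Let czero : chr := add_of (fun _ _ => esym (subrr 0) : 0 = 0 - 0 :> QZ).

Let addB (f g : chr) : {morph (fun x => f x + g x) : x y / x - y}.
Proof. by move=> x y; rewrite !raddfB opprD addrACA. Qed.

Let scaleB s (f : chr) : {morph (fun x => f (act s x)) : x y / x - y}.
Proof. by move=> x y; rewrite actB raddfB. Qed.

Let actN x : act (-1) x = - x.
Proof.
have a0 : act 0 x = 0 by apply: (@addrI _ (act 0 x)); rewrite -actDl !addr0.
by apply/eqP; rewrite -addr_eq0 -[X in _ + X]act1 -actDl addNr a0.
Qed.

(** [act] is a right action (see [actM]), so precomposition with it is a left action on characters.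
    Taking S to be R or R^c covers characters of right and of left modules. *)
Definition character_premod : premod S.
Proof.
refine (@Premod S chr czero (fun f g => add_of (addB f g))
  (fun s f => add_of (scaleB s f)) (fun f g => f =1 g)
  _ _ _ _ _ _ _ _ _ _ _ _ _) => //=.
- by move=> f g h t; rewrite h.
- by move=> f g k h h' t; rewrite h.
- by move=> f f' g g' h h' t /=; rewrite h h'.
- by move=> r f g h t /=; rewrite h.
- by move=> f g h t /=; rewrite addrA.
- by move=> f g t /=; rewrite addrC.
- by move=> f t /=; rewrite add0r.
- by move=> f t /=; rewrite actN raddfN addNr.
- by move=> r s f t /=; rewrite actM.
- by move=> f t /=; rewrite act1.
- by move=> r s f t /=; rewrite actDl raddfD.
Defined.

(** The evaluation pairing e, being full and separating, is all that is used of the character module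
    afterwards. *)
Lemma character_exists : exists (C : lmodType S) (e : T -> C -> QZ),
  [/\ forall x c c', e x (c + c') = e x c + e x c',
      forall x y c, e (x + y) c = e x c + e y c,
      forall s x c, e x (s *: c) = e (act s x) c,
      forall f : {additive T -> QZ}, exists c, forall x, e x c = f x
    & forall c c', (forall x, e x c = e x c') -> c = c'].
Proof.
pose p := character_premod.
exists (qmod p), (fun x (c : qmod p) => (qsec c : chr) x); split.
- move=> x c c'.
  by have := qsec_pi (pm_add (qsec c) (qsec c')) x; rewrite qpiD !qsecK.
- by move=> x y c; rewrite raddfD.
- move=> s x c.
  by have := qsec_pi (pm_scale s (qsec c)) x; rewrite qpiZ !qsecK.
- by move=> f; exists (@qpi _ p f) => x; apply: (@qsec_pi _ p f x).
- by move=> c c' cc'; rewrite -[c]qsecK -[c']qsecK; apply/qpiP.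
Qed.

End Character.

Section Balanced.
Variable R : pzRingType.
Implicit Types (A B : lmodType R^c) (M N : lmodType R).

Lemma left_character_exists A : exists (C : lmodType R) (e : A -> C -> QZ),
  [/\ balanced e, forall f : {additive A -> QZ}, exists c, forall x, e x c = f x
    & forall c c', (forall x, e x c = e x c') -> c = c'].
Proof.
have [||||C [e [eD eD' eZ efull esep]]] :=
    @character_exists R A (fun r a => (r : R^c) *: a).
- by move=> s x y; rewrite scalerBr.
- by move=> x; rewrite scale1r.
- by move=> r s x; rewrite scalerA.
- by move=> r s x; rewrite scalerDl.
by exists C, e; split=> //; split=> // a r x; rewrite eZ.
Qed.

Lemma right_character_exists M : exists (C : lmodType R^c) (e : C -> M -> QZ),
  [/\ balanced e, forall f : {additive M -> QZ}, exists c, forall x, e c x = f x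
    & forall c c', (forall x, e c x = e c' x) -> c = c'].
Proof.
have [||||C [e [eD eD' eZ efull esep]]] :=
    @character_exists R^c M (fun r x => (r : R) *: x).
- by move=> s x y; rewrite scalerBr.
- by move=> x; rewrite scale1r.
- by move=> r s x; rewrite scalerA.
- by move=> r s x; rewrite scalerDl.
by exists C, (fun c x => e x c); split=> //; split=> // a r x; rewrite eZ.
Qed.

End Balanced.

(** * Balanced maps and flatness *)

Definition surjective (A B : Type) (f : A -> B) : Prop :=
  forall y, exists x, f x = y.

Definition exact_at (A : Type) (B C : zmodType) (f : A -> B) (g : B -> C) : Prop :=
  forall y, g y = 0 <-> exists x, f x = y.

Section BalancedMaps.
Variable R : pzRingType.

Section Basic.
Variables (A : lmodType R^c) (M : lmodType R) (t : A -> M -> QZ).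
Hypothesis bt : balanced t.

Lemma balDl a b x : t (a + b) x = t a x + t b x. Proof. by case: bt. Qed.
Lemma balDr a x y : t a (x + y) = t a x + t a y. Proof. by case: bt. Qed.
Lemma balZ a (r : R) x : t ((r : R^c) *: a) x = t a (r *: x).
Proof. by case: bt. Qed.
Lemma bal0l x : t 0 x = 0.
Proof. by apply: (@addrI _ (t 0 x)); rewrite -balDl !addr0. Qed.
Lemma bal0r a : t a 0 = 0.
Proof. by apply: (@addrI _ (t a 0)); rewrite -balDr !addr0. Qed.
Lemma balNl a x : t (- a) x = - t a x.
Proof. by apply/eqP; rewrite -addr_eq0 -balDl addNr bal0l. Qed.
Lemma balNr a x : t a (- x) = - t a x.
Proof. by apply/eqP; rewrite -addr_eq0 -balDr addNr bal0r. Qed.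
Lemma balBl a b x : t (a - b) x = t a x - t b x.
Proof. by rewrite balDl balNl. Qed.
Lemma balBr a x y : t a (x - y) = t a x - t a y.
Proof. by rewrite balDr balNr. Qed.

Lemma bal_compl (A' : lmodType R^c) (f : {linear A' -> A}) :
  balanced (fun a x => t (f a) x).
Proof.
split=> [a b x|a x y|a r x]; first by rewrite linearD balDl.
  by rewrite balDr.
by rewrite linearZ balZ.
Qed.

Lemma bal_compr (M' : lmodType R) (f : {linear M' -> M}) :
  balanced (fun a x => t a (f x)).
Proof.
split=> [a b x|a x y|a r x]; first by rewrite balDl.
  by rewrite linearD balDr.
by rewrite linearZ balZ.
Qed.

Lemma bal_descendl (A' : lmodType R^c) (q : {linear A -> A'}) :
  surjective q -> (forall a x, q a = 0 -> t a x = 0) ->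
  exists t' : A' -> M -> QZ, balanced t' /\ forall a x, t' (q a) x = t a x.
Proof.
move=> /choice[s sK] t0; have tE a b x : q a = q b -> t a x = t b x.
  move=> qab; apply/eqP; rewrite -subr_eq0 -balBl; apply/eqP/t0.
  by rewrite linearB qab subrr.
exists (fun a x => t (s a) x); split=> [|a x]; last by apply: tE.
split=> [a b x|a x y|a r x]; last 1 first.
- by rewrite -balZ; apply: tE; rewrite linearZ !sK.
- by rewrite -balDl; apply: tE; rewrite linearD !sK.
- by rewrite balDr.
Qed.

Lemma bal_descendr (M' : lmodType R) (q : {linear M -> M'}) :
  surjective q -> (forall a x, q x = 0 -> t a x = 0) ->
  exists t' : A -> M' -> QZ, balanced t' /\ forall a x, t' a (q x) = t a x.
Proof.
move=> /choice[s sK] t0; have tE a x y : q x = q y -> t a x = t a y.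
  move=> qxy; apply/eqP; rewrite -subr_eq0 -balBr; apply/eqP/t0.
  by rewrite linearB qxy subrr.
exists (fun a x => t a (s x)); split=> [|a x]; last by apply: tE.
split=> [a b x|a x y|a r x]; last 1 first.
- by rewrite balZ; apply: tE; rewrite linearZ !sK.
- by rewrite balDl.
- by rewrite -balDr; apply: tE; rewrite linearD !sK.
Qed.

(** The adjunction Hom(A (x) M, QZ) = Hom(M, Hom(A, QZ)); [bal_right_char] is its mirror image. *)
Lemma bal_left_char (C : lmodType R) (e : A -> C -> QZ) :
  balanced e -> (forall f : {additive A -> QZ}, exists c, forall x, e x c = f x) ->
  (forall c c', (forall x, e x c = e x c') -> c = c') ->
  exists h : {linear M -> C}, forall a x, e a (h x) = t a x.
Proof.
move=> [eD eD' eZ] efull esep.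
have tB x : {morph t^~ x : a b / a - b} by move=> a b; rewrite balBl.
have [h hP] := choice (fun x => efull (add_of (tB x))).
have hL : linear h.
  apply: linP => [x y|r x]; apply: esep => a; rewrite ?eD' -?eZ !hP /=.
    by rewrite balDr.
  by rewrite balZ.
by exists (lin_of hL) => a x; apply: hP.
Qed.

Lemma bal_right_char (C : lmodType R^c) (e : C -> M -> QZ) :
  balanced e -> (forall f : {additive M -> QZ}, exists c, forall x, e c x = f x) ->
  (forall c c', (forall x, e c x = e c' x) -> c = c') ->
  exists h : {linear A -> C}, forall a x, e (h a) x = t a x.
Proof.
move=> [eD eD' eZ] efull esep.
have tB a : {morph t a : x y / x - y} by move=> x y; rewrite balBr.
have [h hP] := choice (fun a => efull (add_of (tB a))).
have hL : linear h.
  apply: linP => [a b|r a]; apply: esep => x; rewrite ?eD ?eZ !hP /=.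
    by rewrite balDl.
  by rewrite balZ.
by exists (lin_of hL) => a x; apply: hP.
Qed.

End Basic.

Lemma balB (A : lmodType R^c) (M : lmodType R) (s t : A -> M -> QZ) :
  balanced s -> balanced t -> balanced (fun a x => s a x - t a x).
Proof.
move=> bs bt; split=> [a b x|a x y|a r x].
- by rewrite !balDl // opprD addrACA.
- by rewrite !balDr // opprD addrACA.
- by rewrite !balZ.
Qed.

(* These say that - (x) M, resp. A (x) -, keeps the given map injective: a map
   of abelian groups is injective iff homomorphisms to QZ extend along it. *)
Definition extends_left (A B : lmodType R^c) (f : A -> B) (M : lmodType R) :=
  forall t : A -> M -> QZ, balanced t ->
  exists t' : B -> M -> QZ, balanced t' /\ forall a x, t' (f a) x = t a x.

Definition extends_right (A : lmodType R^c) (M N : lmodType R) (i : M -> N) :=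
  forall t : A -> M -> QZ, balanced t ->
  exists t' : A -> N -> QZ, balanced t' /\ forall a x, t' a (i x) = t a x.

Definition lflat (M : lmodType R) : Prop :=
  forall (A B : lmodType R^c) (f : {linear A -> B}),
    injective f -> extends_left f M.

Definition rflat (A : lmodType R^c) : Prop :=
  forall (M N : lmodType R) (i : {linear M -> N}),
    injective i -> extends_right A i.

Definition projective (P : lmodType R) : Prop :=
  forall (N N' : lmodType R) (q : {linear N -> N'}) (a : {linear P -> N'}),
    surjective q -> exists b : {linear P -> N}, forall x, q (b x) = a x.

(** A balanced map on A x P is a linear map from P to the character module of A. Restriction of
    characters along the injective f is onto, so this map lifts to the character module of B. *)
Lemma projective_lflat P : projective P -> lflat P.
Proof.
move=> projP A B f f_inj t bt.
have [CA [eA [beA fullA sepA]]] := left_character_exists A.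
have [CB [eB [beB fullB sepB]]] := left_character_exists B.
have [r rP] := bal_left_char (bal_compl beB f) beA fullA sepA.
have [u uP] := bal_left_char bt beA fullA sepA.
have [c|v vP] := projP _ _ r u.
  have cB : {morph eA^~ c : a b / a - b} by move=> a b; rewrite balBl.
  have [g gP] := additive_extend_along f_inj cB.
  have [c' c'P] := fullB g; exists c'; apply: sepA => a.
  by rewrite rP c'P gP.
exists (fun b x => eB b (v x)); split; first exact: bal_compr.
by move=> a x; rewrite -rP vP uP.
Qed.

(** The mirror image of [projective_lflat], with the lift chosen directly on the generators. *)
Lemma free_rflat (X : Type) (F : lmodType R^c) (g : X -> F) :
  (forall (N : lmodType R^c) (a : X -> N),
     exists h : {linear F -> N}, forall x, h (g x) = a x) ->
  (forall (N : lmodType R^c) (h h' : {linear F -> N}),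
     (forall x, h (g x) = h' (g x)) -> h =1 h') ->
  rflat F.
Proof.
move=> Fex Funi M N i i_inj t bt.
have [CM [eM [beM fullM sepM]]] := right_character_exists M.
have [CN [eN [beN fullN sepN]]] := right_character_exists N.
have [r rP] := bal_right_char (bal_compr beN i) beM fullM sepM.
have [u uP] := bal_right_char bt beM fullM sepM.
have /choice[c cP] x : exists c, forall m, eN c (i m) = t (g x) m.
  have tB : {morph t (g x) : a b / a - b} by move=> a b; rewrite balBr.
  have [h hP] := additive_extend_along i_inj tB.
  by have [c cP] := fullN h; exists c => m; rewrite cP hP.
have [h hP] := Fex _ c.
exists (fun a x => eN (h a) x); split; first exact: bal_compl.
have ruE : r \o h =1 u.
  apply: Funi => x; apply: sepM => m.
  by rewrite uP -cP -hP /= rP.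
by move=> a x; rewrite -rP -uP -ruE.
Qed.

Lemma right_cover_exists (B : lmodType R^c) :
  exists (P : lmodType R^c) (p : {linear P -> B}), rflat P /\ surjective p.
Proof.
have [P [g [Pex Puni]]] := @free_exists R^c B.
have [p pP] := Pex B id.
by exists P, p; split; [apply: free_rflat Pex Puni|move=> b; exists (g b)].
Qed.

Lemma left_cover_exists (M : lmodType R) :
  exists (Q : lmodType R) (q : {linear Q -> M}), projective Q /\ surjective q.
Proof.
have [Q [g [Qex Quni]]] := @free_exists R M.
have [q qP] := Qex M id.
exists Q, q; split; last by move=> x; exists (g x).
move=> N N' p a /choice[s sP].
have [b bP] := Qex N (fun x => s (a (g x))).
by exists b; apply: (Quni _ (p \o b) a) => x /=; rewrite bP sP.
Qed.

(** * Dimension shifting along short exact sequences on both sides *)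

Section Shift.
Variables (K P L : lmodType R^c) (f : {linear K -> P}) (g : {linear P -> L}).
Variables (M' Q M : lmodType R) (i : {linear M' -> Q}) (q : {linear Q -> M}).
Hypotheses (f_inj : injective f) (g_surj : surjective g) (fgP : exact_at f g).
Hypotheses (i_inj : injective i) (q_surj : surjective q) (iqP : exact_at i q).

Let gf k : g (f k) = 0. Proof. by apply/fgP; exists k. Qed.
Let qi x : q (i x) = 0. Proof. by apply/iqP; exists x. Qed.

(** Snake lemma in dual form. By flatness t, pulled back to P, extends to P x Q; on K x Q the
    extension factors through M. Subtracting an extension of that factor to P x M leaves a map that
    vanishes on K and so descends to L. The converse below exchanges the roles of the two
    sequences. *)
Lemma extends_right_of_left :
  rflat P -> extends_left f M -> extends_right L i.
Proof.
move=> flatP extM t bt.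
have [s [bs sP]] := flatP _ _ i i_inj _ (bal_compl bt g).
have [|u [bu uP]] := bal_descendr (bal_compl bs f) q_surj.
  by move=> k y /iqP[x <-]; rewrite sP gf bal0l.
have [u' [bu' u'P]] := extM _ bu.
have [|w [bw wP]] := bal_descendl (balB bs (bal_compr bu' q)) g_surj.
  by move=> p y /fgP[k <-]; rewrite u'P uP subrr.
exists w; split=> // a x; have [p <-] := g_surj a.
by rewrite wP sP qi bal0r // subr0.
Qed.

Lemma extends_left_of_right :
  extends_left f Q -> extends_right L i -> extends_left f M.
Proof.
move=> extQ extL t bt.
have [s [bs sP]] := extQ _ (bal_compr bt q).
have [|u [bu uP]] := bal_descendl (bal_compr bs i) g_surj.
  by move=> p x /fgP[k <-]; rewrite sP qi bal0r.
have [u' [bu' u'P]] := extL _ bu.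
have [|w [bw wP]] := bal_descendr (balB bs (bal_compl bu' g)) q_surj.
  by move=> p y /iqP[x <-]; rewrite u'P uP subrr.
exists w; split=> // k m; have [y <-] := q_surj m.
by rewrite wP sP gf bal0l // subr0.
Qed.

End Shift.

Section Square.
Variables (L P : lmodType R^c) (h : {linear L -> P}).
Variables (M' Q : lmodType R) (i : {linear M' -> Q}).
Hypotheses (h_inj : injective h) (i_inj : injective i).

(** Both lemmas of this section read L (x) M' -> P (x) Q around the square in its two ways: if the
    composite is injective, so is its first factor on either side. *)
Lemma extends_left_right : rflat P -> extends_left h M' -> extends_right L i.
Proof.
move=> flatP extM t /extM[s [bs sP]].
have [u [bu uP]] := flatP _ _ i i_inj _ bs.
exists (fun a y => u (h a) y); split; first exact: bal_compl.
by move=> a x; rewrite uP sP.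
Qed.

Lemma extends_right_left : lflat Q -> extends_right L i -> extends_left h M'.
Proof.
move=> flatQ extL t /extL[s [bs sP]].
have [u [bu uP]] := flatQ _ _ h h_inj _ bs.
exists (fun a y => u a (i y)); split; first exact: bal_compr.
by move=> a x; rewrite uP sP.
Qed.

End Square.

(* f is the start of an exact sequence 0 -> K -> P -> ... -> P_0 of length n
   with flat terms. *)
Fixpoint syzygy_mono n (K P : lmodType R^c) (f : {linear K -> P}) : Prop :=
  [/\ injective f, rflat P &
   match n with
   | 0%N => True
   | n'.+1 => exists (L P' : lmodType R^c) (g : {linear P -> L})
       (h : {linear L -> P'}),
       [/\ surjective g, exact_at f g & syzygy_mono n' h]
   end].

(* The vanishing of Tor_(n+1) (-, M). *)
Definition tor_vanishes n (M : lmodType R) : Prop :=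
  forall (K P : lmodType R^c) (f : {linear K -> P}),
    syzygy_mono n f -> extends_left f M.

Lemma syzygy_mono_inj n (K P : lmodType R^c) (f : {linear K -> P}) :
  syzygy_mono n f -> injective f.
Proof. by case: n => [|n] []. Qed.

Lemma syzygy_mono_rflat n (K P : lmodType R^c) (f : {linear K -> P}) :
  syzygy_mono n f -> rflat P.
Proof. by case: n => [|n] []. Qed.

Lemma lflat_tor_vanishes n M : lflat M -> tor_vanishes n M.
Proof. by move=> flatM K P f /syzygy_mono_inj f_inj; apply: flatM. Qed.

(** The hypothesis concerns injections into flat modules. A general A -> B is pulled back along a
    flat cover p of B; the map extended from the pullback vanishes on ker p, hence descends to B. *)
Lemma tor_vanishes0 M : tor_vanishes 0 M -> lflat M.
Proof.
move=> torM A B f f_inj t bt.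
have [P [p [flatP p_surj]]] := right_cover_exists B.
have subA : submodule (fun x => exists a, f a = p x).
  split; first by exists 0; rewrite !linear0.
  by move=> r x y [a fa] [b fb]; exists (r *: a + b); rewrite !linearP fa fb.
have [A' [k [k_inj kP]]] := submodule_exists subA.
have /choice[pi piP] a' : exists a, f a = p (k a').
  by apply/kP; exists a'.
have piL : linear pi.
  by move=> r a b; apply: f_inj; rewrite linearP !piP !linearP.
have [s [bs sP]] :=
  torM _ _ k (And3 k_inj flatP I) _ (bal_compl bt (lin_of piL)).
have [|w [bw wP]] := bal_descendl bs p_surj.
  move=> x m px; have [|a' ka'] := (kP x).1; first by exists 0; rewrite px linear0.
  rewrite -ka' sP /= (_ : pi a' = 0) ?bal0l //; apply: f_inj.
  by rewrite piP ka' px linear0.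
exists w; split=> // a m; have [x px] := p_surj (f a).
have [|a' ka'] := (kP x).1; first by exists a.
rewrite -px wP -ka' sP /=; congr (t _ m); apply: f_inj.
by rewrite piP ka' px.
Qed.

End BalancedMaps.

(** * Flat dimension as vanishing of Tor *)

Section FlatDimension.
Variable R : pzRingType.

(** An additive map is injective iff characters extend along it: one direction is injectivity of
    [QZ], the other that [QZ] cogenerates. *)
Lemma flat_lflat (F : lmodType R) : flat F <-> lflat F.
Proof.
split=> [flatF A B f f_inj t bt|flatF A B f f_inj TA TB tA tB uniA uniB h hP].
  have [TA [tA uniA]] := tensor_exists A F.
  have [TB [tB uniB]] := tensor_exists B F.
  have [bB _] := uniB.
  have bBf : balanced (fun a x => tB (f a) x).
    case: bB => bD bD' bZ.
    by split=> [a b x|a x y|a r x]; rewrite ?linearD ?linearZ ?bD ?bD' ?bZ.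
  have [[h hP] _] := uniA.2 _ _ bBf.
  have [[chi chiP] _] := uniA.2 _ _ bt.
  have h_inj := flatF _ _ f f_inj _ _ _ _ uniA uniB h hP.
  have [|chi' chi'P] := @additive_extend_along _ _ h chi h_inj.
    by move=> x y; rewrite raddfB.
  exists (fun b x => chi' (tB b x)); split=> [|a x].
    case: bB => bD bD' bZ.
    by split=> [a b x|a x y|a r x]; rewrite ?bD ?bD' ?bZ ?raddfD.
  by rewrite -hP chi'P chiP.
move=> u v huv; apply: contrapT => uv.
have [chi] := @QZ_cogenerator _ (u - v) (fun e => uv (subr0_eq e)).
apply; have [bA _] := uniA.
have bt : balanced (fun a x => chi (tA a x)).
  case: bA => bD bD' bZ.
  by split=> [a b x|a x y|a r x]; rewrite ?bD ?bD' ?bZ ?raddfD.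
have [t' [bt' t'P]] := flatF _ _ f f_inj _ bt.
have [[k kP] _] := uniB.2 _ _ bt'.
have [_ uni] := uniA.2 _ _ bt.
have hB : {morph (fun x => k (h x)) : x y / x - y}.
  by move=> x y; rewrite !raddfB.
have -> : chi (u - v) = add_of hB (u - v).
  by apply: uni => // a x; rewrite /= hP kP t'P.
by rewrite /= raddfB huv subrr raddf0.
Qed.

Lemma extends_left_iso (M N : lmodType R) (e : {linear M -> N})
    (A B : lmodType R^c) (f : {linear A -> B}) :
  injective e -> surjective e -> extends_left f M -> extends_left f N.
Proof.
move=> e_inj e_surj extM t bt.
have [s [bs sP]] := extM _ (bal_compr bt e).
have [|w [bw wP]] := bal_descendr bs e_surj.
  move=> b x ex; suff -> : x = 0 by rewrite bal0r.
  by apply: e_inj; rewrite ex linear0.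
exists w; split=> // a y; have [x <-] := e_surj y.
by rewrite wP sP.
Qed.

Lemma flat_dim_le0 (M : lmodType R) : flat_dim_le 0 M <-> lflat M.
Proof.
split=> [[F [d [e [flatF F0 e_surj ke _]]]]|flatM].
  have e_inj : injective e.
    move=> x y exy; apply: subr0_eq; have [|z <-] := (ke (x - y)).1.
      by rewrite linearB exy subrr.
    by rewrite (F0 1%N isT z) linear0.
  move=> A B f f_inj; apply: extends_left_iso e_inj e_surj _.
  by have /flat_lflat := flatF 0%N isT; apply.
(* The module of row vectors of length 0 serves as the zero module. *)
pose F k : lmodType R := if k is k'.+1 then 'rV[R]_0 else M.
have F0 k (x : F k.+1) : x = 0 by apply: thinmx0.
exists F, (fun k => \0 : {linear F k.+1 -> F k}), (idfun : {linear F 0%N -> M}).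
split=> [||y|x|k x].
- by case=> // _; apply/flat_lflat.
- by case=> // k _ x; apply: (F0 k x).
- by exists y.
- by split=> [/= ->|[y /= <-] //]; exists 0.
- by split=> // _; exists 0; rewrite [x]F0.
Qed.

Lemma flat_dim_leS n (M : lmodType R) : flat_dim_le n.+1 M <->
  exists (Q M' : lmodType R) (i : {linear M' -> Q}) (q : {linear Q -> M}),
    [/\ lflat Q, injective i, surjective q, exact_at i q & flat_dim_le n M'].
Proof.
split=> [[F [d [e [flatF F0 e_surj ke kd]]]]|].
  have subK : submodule (fun x => e x = 0).
    by split=> [|r x y ex ey]; rewrite ?linear0 // linearP ex ey scaler0 addr0.
  have [M' [i [i_inj iP]]] := submodule_exists subK.
  exists (F 0%N), M', i, e; split=> //.
    by apply/flat_lflat/flatF.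
  have /choice[e' e'P] x : exists y, i y = d 0%N x.
    by apply/iP/ke; exists x.
  have e'L : linear e'.
    by move=> r a b; apply: i_inj; rewrite linearP !e'P linearP.
  exists (fun k => F k.+1), (fun k => d k.+1), (lin_of e'L); split=> /=.
  - by move=> k kn; apply: flatF.
  - by move=> k kn; apply: F0.
  - move=> y; have /ke[x dx] : e (i y) = 0 by apply/iP; exists y.
    by exists x; apply: i_inj; rewrite e'P.
  - move=> x; rewrite -kd -e'P; split=> [->|ie]; first by rewrite linear0.
    by apply: i_inj; rewrite ie linear0.
  - by move=> k x; apply: kd.
case=> Q [M' [i [q [flatQ i_inj q_surj iqP [F [d [e [flatF F0 e_surj ke kd]]]]]]]].
pose F' k : lmodType R := if k is k'.+1 then F k' else Q.
pose d' k : {linear F' k.+1 -> F' k} :=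
  match k with 0%N => (i \o e : {linear F' 1%N -> F' 0%N}) | k'.+1 => d k' end.
exists F', d', q; split=> [||//|x|[|k] x].
- by case=> [_|k kn]; [apply/flat_lflat|apply: flatF].
- by case=> // k kn x; apply: F0.
- rewrite iqP; split=> [[y <-]|[y <-]]; last by exists (e y).
  by have [z <-] := e_surj y; exists z.
- rewrite -ke /=; split=> [ie|->]; last by rewrite linear0.
  by apply: i_inj; rewrite ie linear0.
- exact: kd.
Qed.

(** For 0 -> M' -> Q -> M -> 0 with Q flat, injectivity of f (x) M is passed to L (x) i and on to h
    (x) M', where h is the next map of the flat sequence, and back. In the converse a flat cover of
    L prolongs a sequence of length n to one of length n + 1. *)
Theorem flat_dim_tor n (M : lmodType R) : flat_dim_le n M <-> tor_vanishes n M.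
Proof.
elim: n M => [|n IHn] M.
  by rewrite flat_dim_le0; split; [apply: lflat_tor_vanishes|apply: tor_vanishes0].
rewrite flat_dim_leS; split.
  move=> [Q [M' [i [q [flatQ i_inj q_surj iqP /IHn torM']]]]].
  move=> K P f [f_inj flatP [L [P' [g [h [g_surj fgP syzh]]]]]].
  apply: (extends_left_of_right g_surj fgP q_surj iqP); first exact: flatQ.
  exact: extends_left_right i_inj (syzygy_mono_rflat syzh) (torM' _ _ _ syzh).
move=> torM; have [Q [q [/projective_lflat flatQ q_surj]]] := left_cover_exists M.
have subK : submodule (fun x => q x = 0).
  by split=> [|r x y ex ey]; rewrite ?linear0 // linearP ex ey scaler0 addr0.
have [M' [i [i_inj iqP]]] := submodule_exists subK.
exists Q, M', i, q; split=> //; apply/IHn => L P' h syzh.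
have [P [g [flatP g_surj]]] := right_cover_exists L.
have subL : submodule (fun x => g x = 0).
  by split=> [|r x y ex ey]; rewrite ?linear0 // linearP ex ey scaler0 addr0.
have [K [f [f_inj fgP]]] := submodule_exists subL.
apply: (extends_right_left (syzygy_mono_inj syzh) flatQ).
apply: (extends_right_of_left g_surj fgP i_inj q_surj iqP flatP).
by apply: torM; split=> //; exists L, P', g, h.
Qed.

End FlatDimension.

(** * Purity *)

Section Purity.
Variable R : pzRingType.

Definition lsum (T : Type) (M : lmodType R) (e : seq (R * T)) (v : T -> M) : M :=
  \sum_(p <- e) p.1 *: v p.2.

Lemma lsum_map (T T' : Type) (M : lmodType R) (g : T -> T') e (v : T' -> M) :
  lsum [seq (p.1, g p.2) | p <- e] v = lsum e (v \o g).
Proof. by rewrite /lsum big_map. Qed.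

Lemma lsum_linear (T : Type) (M N : lmodType R) (h : {linear M -> N}) e
    (v : T -> M) : h (lsum e v) = lsum e (h \o v).
Proof.
by rewrite /lsum linear_sum; apply: eq_bigr => p _; rewrite linearZ.
Qed.

Lemma eq_lsum (T : eqType) (M : lmodType R) (e : seq (R * T)) (v v' : T -> M) :
  (forall p, p \in e -> v p.2 = v' p.2) -> lsum e v = lsum e v'.
Proof. by move=> h; apply: eq_big_seq => p /h ->. Qed.

Lemma lsumD (T : Type) (M : lmodType R) (e : seq (R * T)) (v v' : T -> M) :
  lsum e (fun x => v x + v' x) = lsum e v + lsum e v'.
Proof.
by rewrite /lsum -big_split; apply: eq_bigr => p _; rewrite scalerDr.
Qed.

Lemma lsumB (T : Type) (M : lmodType R) (e : seq (R * T)) (v v' : T -> M) :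
  lsum e (fun x => v x - v' x) = lsum e v - lsum e v'.
Proof.
by rewrite /lsum -sumrB; apply: eq_bigr => p _; rewrite scalerBr.
Qed.

(** Finite linear systems with constants in N that are solvable in M are solvable in N. The
    constants are presented as the values [lsum e v] at the solution v in M. *)
Definition pure (M : lmodType R) (N : M -> Prop) : Prop :=
  submodule N /\
  forall (sys : seq (seq (R * nat))) (v : nat -> M),
    (forall e, e \in sys -> N (lsum e v)) ->
  exists v' : nat -> M, (forall i, N (v' i)) /\
    forall e, e \in sys -> lsum e v' = lsum e v.

(** The elements of M that occur in [ws] become the unknowns, numbered by their place in a list and
    solved by themselves in M; [phi] reads off a solution in N. It is a retraction onto N as far as
    the finitely many combinations in [ws] can tell. *)
Lemma pure_local (M : lmodType R) (N : M -> Prop) : pure N ->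
  forall ws : seq (seq (R * M)), exists phi : M -> M, (forall x, N (phi x)) /\
    forall w, w \in ws -> N (lsum w id) -> lsum w phi = lsum w id.
Proof.
move=> [_ pureN] ws.
pose ws' := [seq w <- ws | `[< N (lsum w id) >]].
pose L := flatten [seq [seq p.2 | p <- w] | w <- ws'].
pose enc (w : seq (R * M)) := [seq (p.1, index p.2 L) | p <- w].
have encv w : w \in ws' -> lsum (enc w) (nth 0 L) = lsum w id.
  move=> w_ws; rewrite /enc (lsum_map (index^~ L)); apply: eq_lsum => p pw.
  apply: nth_index.
  by apply/flatten_mapP; exists w => //; apply: map_f.
have [e /mapP[w w_ws ->]|v' [Nv' v'P]] := pureN [seq enc w | w <- ws'] (nth 0 L).
  by rewrite encv //; move: w_ws; rewrite mem_filter => /andP[/asboolP].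
exists (v' \o index^~ L); split=> [x|w w_ws Nw]; first exact: Nv'.
have w_ws' : w \in ws' by rewrite mem_filter w_ws andbT; apply/asboolP.
by rewrite -(lsum_map (index^~ L)) -/(enc w) v'P ?encv //; apply: map_f.
Qed.

(** A solution u in N of the image system lifts to M with an error in ker q; purity of ker q solves
    the system of errors there. *)
Lemma pure_preimage (M L : lmodType R) (q : {linear M -> L}) (N : L -> Prop) :
  surjective q -> pure (fun x => q x = 0) -> pure N -> pure (fun x => N (q x)).
Proof.
move=> /choice[s sK] [_ pureK] [subN pureN]; split.
  split=> [|r x y Nx Ny]; first by rewrite linear0; apply: submodule0.
  by rewrite linearP; apply: (proj2 subN).
move=> sys v Nv.
have [e e_sys|u [Nu uP]] := pureN sys (q \o v).
  by rewrite -lsum_linear; apply: Nv.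
have [e e_sys|w [Nw wP]] := pureK sys (fun i => v i - s (u i)).
  rewrite lsum_linear -(subrr (lsum e (q \o v))) -{2}uP // -lsumB.
  by apply: eq_lsum => p _ /=; rewrite linearB sK.
exists (fun i => w i + s (u i)); split=> [i|e e_sys].
  by rewrite linearD Nw add0r sK.
by rewrite lsumD wP // lsumB subrK.
Qed.

(* A generalized limit along the finite subsets of J. It exists because QZ is
   injective, and it makes purity give extensions of balanced maps without any
   computation in tensor products. *)
Lemma eventual_value_exists (J : eqType) :
  exists rho : {additive (seq J -> QZ) -> QZ}, forall (f : seq J -> QZ) d,
    (exists j0 : seq J, forall j, (forall w, w \in j0 -> w \in j) -> f j = d) ->
    rho f = d.
Proof.
pose ev (f : seq J -> QZ) d := exists j0 : seq J,
  forall j, (forall w, w \in j0 -> w \in j) -> f j = d.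
have ev_fun f d d' : ev f d -> ev f d' -> d = d'.
  move=> [j0 h] [j0' h']; rewrite -(h (j0 ++ j0')) ?(h' (j0 ++ j0')) // => w wj.
    by rewrite mem_cat orbC ?wj.
  by rewrite mem_cat ?wj.
have evB f g d e : ev f d -> ev g e -> ev (f - g) (d - e).
  move=> [j0 h] [j0' h']; exists (j0 ++ j0') => j sub.
  rewrite /= -[LHS]/(f j - g j) h ?h' // => w wj; apply: sub.
    by rewrite mem_cat orbC ?wj.
  by rewrite mem_cat ?wj.
have [f0 f0P] : exists f0, forall f d, ev f d -> f0 f = d.
  have h f : exists d, forall d', ev f d' -> d = d'.
    have [[d fd]|n] := pselect (exists d, ev f d).
      by exists d => d'; apply: ev_fun.
    by exists 0 => d fd; case: n; exists d.
  by have [f0 f0P] := choice h; exists f0.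
have [||f g [d fd] [e ge]|rho rhoP] :=
    @QZ_extends (seq J -> QZ) (fun f => exists d, ev f d) f0.
- by exists 0, [::].
- by move=> f g [d fd] [e ge]; exists (d - e); apply: evB.
- by rewrite (f0P _ _ fd) (f0P _ _ ge); apply/f0P/evB.
by exists rho => f d fd; rewrite rhoP; [apply: f0P|exists d].
Qed.

(** The extension is the limit of t a (phi x) over the local retractions phi. Each identity in x
    holds from the stage at which the relation expressing it belongs to [ws]. *)
Lemma pure_extends_right (M' M : lmodType R) (i : {linear M' -> M})
    (A : lmodType R^c) :
  injective i -> pure (fun x => exists y, i y = x) -> extends_right A i.
Proof.
move=> i_inj pureN t bt.
have /choice[phi phiP] (ws : seq (seq (R * M))) : exists phi : M -> M',
    forall w, w \in ws -> (exists y, i y = lsum w id) ->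
    lsum w (i \o phi) = lsum w id.
  have [phi [/choice[j jP] phiP]] := pure_local pureN ws.
  exists j => w ww wN; rewrite -(phiP _ ww wN).
  by apply: eq_lsum => p _ /=; rewrite jP.
have [rho rhoP] := eventual_value_exists (seq (R * M)).
pose F a x : seq (seq (R * M)) -> QZ := fun ws => t a (phi ws x).
have mem_one (w : seq (R * M)) (ws : seq (seq (R * M))) :
    (forall w', w' \in [:: w] -> w' \in ws) -> w \in ws.
  by apply; rewrite inE.
(* The combination r x + y - z has the value 0, which lies in the submodule, so [phi ws] preserves
   it. *)
have lin2 (r : R) x y z (ws : seq (seq (R * M))) :
    r *: x + y = z -> [:: (r, x); (1, y); (-1, z)] \in ws ->
    r *: phi ws x + phi ws y = phi ws z.
  move=> e /phiP; rewrite /lsum !big_cons !big_nil /= !scaleN1r !scale1r !addr0.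
  rewrite !addrA e subrr => h; apply: i_inj; rewrite linearP.
  by apply: subr0_eq; apply: h; exists 0; rewrite linear0.
have rhoL a r x y :
    rho (F a (r *: x + y)) = rho (F ((r : R^c) *: a) x) + rho (F a y).
  apply: subr0_eq; rewrite -!raddfD -raddfB; apply: rhoP.
  exists [:: [:: (r, x); (1, y); (-1, r *: x + y)]] => ws /mem_one h.
  rewrite -[LHS]/(t a (phi ws (r *: x + y)) - (t _ (phi ws x) + t a (phi ws y))).
  by rewrite -(lin2 r x y _ ws erefl h) (balDr bt) -(balZ bt) subrr.
have rho0 a : rho (F a 0) = 0.
  have := rhoL a 1 0 0; rewrite !scale1r addr0 => e.
  by apply: (@addrI _ (rho (F a 0))); rewrite -e addr0.
exists (fun a x => rho (F a x)); split; last first.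
  move=> a y; apply: rhoP; exists [:: [:: (1, i y)]] => ws /mem_one h.
  congr (t a _); apply: i_inj; have := phiP ws _ h.
  by rewrite /lsum !big_cons !big_nil /= !scale1r !addr0; apply; exists y.
split=> [a b x|a x y|a r x].
- rewrite -raddfD; congr (rho _); apply: funext => ws.
  exact: (balDl bt).
- by have := rhoL a 1 x y; rewrite !scale1r.
- by have := rhoL a r x 0; rewrite addr0 rho0 addr0.
Qed.

Lemma pure_sub_tor n (M' M : lmodType R) (i : {linear M' -> M}) :
  injective i -> pure (fun x => exists y, i y = x) ->
  tor_vanishes n M -> tor_vanishes n M'.
Proof.
move=> i_inj pureN torM K P f syzf t bt.
have [s [bs sP]] := pure_extends_right i_inj pureN bt.
have [u [bu uP]] := torM _ _ f syzf _ bs.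
exists (fun a x => u a (i x)); split; first exact: bal_compr.
by move=> a x; rewrite uP sP.
Qed.

(** With [L0] = P / K, purity of ker q keeps ker q -> M injective after tensoring with [L0], and
    dimension shifting transfers injectivity from f (x) M to f (x) L. *)
Lemma pure_quotient_tor n (M L : lmodType R) (q : {linear M -> L}) :
  surjective q -> pure (fun x => q x = 0) ->
  tor_vanishes n M -> tor_vanishes n L.
Proof.
move=> q_surj pureK torM K P f syzf.
have [M' [i [i_inj iqP]]] := submodule_exists (proj1 pureK).
have subK : submodule (fun x => exists y, f y = x).
  split=> [|r _ _ [x <-] [y <-]]; first by exists 0; rewrite linear0.
  by exists (r *: x + y); rewrite linearP.
have [L0 [g [g_surj fgP]]] := quotient_exists subK.
apply: (extends_left_of_right g_surj fgP q_surj iqP (torM _ _ f syzf)).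
apply: pure_extends_right i_inj _.
suff <- : (fun x => q x = 0) = (fun x => exists y, i y = x) by [].
by apply: funext => x; apply: propext; apply: iqP.
Qed.

End Purity.

(** * Complexes *)

(** The degrees m + 1 - 1 and m are equal only propositionally, so the family is transported;
    uniqueness of equality proofs in [int] removes the transport. *)
Lemma degree_shift (F : int -> Type) (f : forall m : int, F (m - 1)) :
  exists g : forall m, F m, forall m, g (m - 1) = f m.
Proof.
pose g m : F m := eq_rect _ F (f (m + 1)) _ (addrK 1 m).
exists g => m; rewrite /g.
have e : m - 1 + 1 = m by rewrite subrK.
by move: (addrK 1 (m - 1)); rewrite e => e'; rewrite (eq_axiomK e').
Qed.

Lemma factor_injective (R : pzRingType) (A N M : lmodType R)
    (i : {linear N -> M}) (f : {linear A -> M}) :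
  injective i -> (forall a, exists y, i y = f a) ->
  exists f' : {linear A -> N}, forall a, i (f' a) = f a.
Proof.
move=> i_inj /choice[g gP]; have gL : linear g.
  by move=> r x y; apply: i_inj; rewrite linearP !gP linearP.
by exists (lin_of gL).
Qed.

Lemma factor_surjective (R : pzRingType) (A M L : lmodType R)
    (q : {linear M -> L}) (f : {linear M -> A}) :
  surjective q -> (forall x, q x = 0 -> f x = 0) ->
  exists f' : {linear L -> A}, forall x, f' (q x) = f x.
Proof.
move=> /choice[s sK] f0; have fE x y : q x = q y -> f x = f y.
  by move=> e; apply/subr0_eq; rewrite -linearB f0 // linearB e subrr.
have fL : linear (f \o s).
  by move=> r x y; rewrite /= -linearP; apply: fE; rewrite linearP !sK.
by exists (lin_of fL) => x; apply: fE; rewrite sK.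
Qed.

Lemma family_choice (I : Type) (F G : I -> Type) (P : forall i, F i -> G i -> Prop) :
  (forall i x, exists y, P i x y) ->
  exists f : forall i, F i -> G i, forall i x, P i x (f i x).
Proof.
move=> h; exists (fun i x => sval (cid (h i x))) => i x.
exact: (svalP (cid (h i x))).
Qed.

Section ChainMaps.
Variable R : pzRingType.
Implicit Types X Y Z : complex R.

Definition cm_comp X Y Z (g : chain_map Y Z) (f : chain_map X Y) :
  chain_map X Z.
Proof.
by exists (fun m => g m \o f m : {linear X m -> Z m}) => m x /=;
  rewrite !cmap_diff.
Defined.

Definition cm_id X : chain_map X X.
Proof. by exists (fun m => idfun : {linear X m -> X m}). Defined.

Definition cm_zero X Y : chain_map X Y.
Proof.
by exists (fun m => \0 : {linear X m -> Y m}) => m x /=; rewrite linear0.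
Defined.

Definition cm_sub X Y (f g : chain_map X Y) : chain_map X Y.
Proof.
by exists (fun m => f m \- g m : {linear X m -> Y m}) => m x /=;
  rewrite !cmap_diff linearB.
Defined.

Definition map_of X Y (f : forall m, X m -> Y m) (fL : forall m, linear (f m))
    (fd : forall m x, f (m - 1) (diff X m x) = diff Y m (f m x)) :
  chain_map X Y := @ChainMap R X Y (fun m => lin_of (fL m)) fd.

Lemma pair_linear X Y Z (f : chain_map X Y) (g : chain_map X Z) m :
  linear (fun x => (f m x, g m x) : dsum Z Y m).
Proof. by move=> r x y; rewrite !linearP. Qed.

Lemma pair_diff X Y Z (f : chain_map X Y) (g : chain_map X Z) m x :
  (f (m - 1) (diff X m x), g (m - 1) (diff X m x)) =
  diff (dsum Z Y) m (f m x, g m x).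
Proof. by rewrite !cmap_diff. Qed.

Definition cm_pair X Y Z (f : chain_map X Y) (g : chain_map X Z) :
  chain_map X (dsum Z Y) := map_of (pair_linear f g) (pair_diff f g).

Lemma fst_linear Y Z m : linear (fun x : dsum Z Y m => x.1 : Y m).
Proof. by []. Qed.

Definition cm_fst Y Z : chain_map (dsum Z Y) Y :=
  map_of (@fst_linear Y Z) (fun _ _ => erefl).

Definition subcomplex X (K : forall m, X m -> Prop) : Prop :=
  (forall m, submodule (K m)) /\ forall m x, K m x -> K (m - 1) (diff X m x).

Definition im_map X Y (f : chain_map X Y) m (y : Y m) : Prop :=
  exists x, f m x = y.

Definition ker_map X Y (f : chain_map X Y) m (x : X m) : Prop := f m x = 0.

Definition mono_map X Y (f : chain_map X Y) := forall m, injective (f m).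
Definition epi_map X Y (f : chain_map X Y) := forall m, surjective (f m).

Lemma im_subcomplex X Y (f : chain_map X Y) : subcomplex (im_map f).
Proof.
split=> [m|m _ [x <-]]; last by exists (diff X m x); rewrite cmap_diff.
split=> [|r _ _ [x <-] [y <-]]; first by exists 0; rewrite linear0.
by exists (r *: x + y); rewrite linearP.
Qed.

Lemma ker_subcomplex X Y (f : chain_map X Y) : subcomplex (ker_map f).
Proof.
split=> [m|m x fx]; last by rewrite /ker_map cmap_diff fx linear0.
split=> [|r x y fx fy]; rewrite /ker_map ?linear0 //.
by rewrite linearP fx fy scaler0 addr0.
Qed.

Lemma map_factor_mono A X Y (i : chain_map X Y) (f : chain_map A Y) :
  mono_map i -> (forall m a, im_map i (f m a)) ->
  exists f' : chain_map A X, forall m a, i m (f' m a) = f m a.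
Proof.
move=> i_inj fi.
pose g m := sval (cid (factor_injective (i_inj m) (fi m))).
have gP m a : i m (g m a) = f m a by rewrite /g; case: cid.
have gd m (a : A m) : g (m - 1) (diff A m a) = diff X m (g m a).
  by apply: (i_inj (m - 1)); rewrite gP !cmap_diff gP.
by exists (@ChainMap R A X g gd).
Qed.

Lemma map_factor_epi A X Y (q : chain_map X Y) (f : chain_map X A) :
  epi_map q -> (forall m (x : X m), ker_map q x -> ker_map f x) ->
  exists f' : chain_map Y A, forall m (x : X m), f' m (q m x) = f m x.
Proof.
move=> q_surj qf.
pose g m := sval (cid (factor_surjective (q_surj m) (qf m))).
have gP m x : g m (q m x) = f m x by rewrite /g; case: cid.
have gd m (y : Y m) : g (m - 1) (diff Y m y) = diff A m (g m y).
  by have [x <-] := q_surj m y; rewrite -cmap_diff !gP cmap_diff.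
by exists (@ChainMap R Y A g gd).
Qed.

Lemma quotient_complex_exists X (K : forall m, X m -> Prop) : subcomplex K ->
  exists (L : complex R) (q : chain_map X L),
    epi_map q /\ forall m (x : X m), ker_map q x <-> K m x.
Proof.
move=> [subK dK].
pose L m := sval (cid (quotient_exists (subK m))).
pose q m : {linear X m -> L m} := sval (cid (svalP (cid (quotient_exists (subK m))))).
have qP m : surjective (q m) /\ forall x, q m x = 0 <-> K m x.
  exact: (svalP (cid (svalP (cid (quotient_exists (subK m)))))).
have fP m : exists f : {linear L m -> L (m - 1)},
    forall x, f (q m x) = q (m - 1) (diff X m x).
  have [||f fP] := @factor_surjective R _ _ _ (q m)
    (q (m - 1) \o diff X m : {linear X m -> L (m - 1)}).
  - exact: (qP m).1.
  - by move=> x /((qP m).2 x) Kx; apply/((qP (m - 1)).2 _)/dK.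
  by exists f.
pose d m := sval (cid (fP m)).
have dP m x : d m (q m x) = q (m - 1) (diff X m x) by rewrite /d; case: cid.
have dd m (y : L m) : d (m - 1) (d m y) = 0.
  by have [x <-] := (qP m).1 y; rewrite !dP diff_diff linear0.
exists (Complex dd), (@ChainMap R X (Complex dd) q (fun m x => esym (dP m x))).
by split=> m; case: (qP m).
Qed.

Section TermComplex.
Variables (T : int -> Type) (z : forall m, T m) (add : forall m, T m -> T m -> T m)
  (scale : forall m, R -> T m -> T m) (dif : forall m, T m -> T (m - 1)).
Variables (I : Type) (X : I -> complex R) (ev : forall A m, T m -> X A m).
Hypotheses (ev0 : forall A m, ev A (z m) = 0)
  (evD : forall A m (x y : T m), ev A (add x y) = ev A x + ev A y)
  (evZ : forall A m r (x : T m), ev A (scale r x) = r *: ev A x)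
  (evd : forall A m (x : T m), ev A (dif x) = diff (X A) m (ev A x)).

Lemma term_complex_exists : exists (Q : complex R) (c : forall m, T m -> Q m),
  [/\ forall m, surjective (@c m),
      forall m (x y : T m), c m x = c m y <-> forall A, ev A x = ev A y,
      forall m (x y : T m), c m (add x y) = c m x + c m y,
      forall m r (x : T m), c m (scale r x) = r *: c m x
    & forall m (x : T m), c (m - 1) (dif x) = diff Q m (c m x)] /\
  forall A, exists h : chain_map Q (X A), forall m (x : T m), h m (c m x) = ev A x.
Proof.
have [Q [c [c_surj cP cD cZ]]] : exists (Q : int -> lmodType R)
    (c : forall m, T m -> Q m),
    [/\ forall m, surjective (c m),
        forall m (x y : T m), c m x = c m y <-> forall A, ev A x = ev A y,
        forall m (x y : T m), c m (add x y) = c m x + c m y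
      & forall m r (x : T m), c m (scale r x) = r *: c m x].
  pose p m : premod R := @premod_of R (T m) (z m) (@add m) (@scale m) I
    (fun A => X A m) (fun A => @ev A m) (fun A => ev0 A m) (fun A => @evD A m)
    (fun A => @evZ A m).
  exists (fun m => qmod (p m)), (fun m x => @qpi _ (p m) x); split=> m.
  - by move=> u; exists (qsec u); apply: qsecK.
  - by move=> x y; apply: qpiP.
  - by move=> x y; apply: (@qpiD _ (p m)).
  - by move=> r x; apply: (@qpiZ _ (p m)).
have /family_choice[s sK] : forall m (u : Q m), exists x, c m x = u by apply: c_surj.
have csK m (x : T m) A : ev A (s m (c m x)) = ev A x.
  exact: (iffLR (cP m _ _) (sK m (c m x))).
pose d m (u : Q m) : Q (m - 1) := c (m - 1) (dif (s m u)).
have dc m (x : T m) : d m (c m x) = c (m - 1) (dif x).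
  by apply/cP => A; rewrite !evd csK.
have dL m : linear (d m).
  apply: linP => [u v|r u]; have [x <-] := c_surj m u.
    have [y <-] := c_surj m v; rewrite -(cD m x y) !dc -(cD (m - 1)).
    by apply/cP => A; rewrite evd !evD !evd linearD.
  rewrite -(cZ m r x) !dc -(cZ (m - 1)).
  by apply/cP => A; rewrite evd !evZ !evd linearZ.
have c0 m : c m (z m) = 0.
  apply: (@addrI _ (c m (z m))); rewrite -(cD m) addr0.
  by apply/cP => A; rewrite evD ev0 addr0.
have dd m (u : Q m) : lin_of (dL (m - 1)) (lin_of (dL m) u) = 0.
  have [x <-] := c_surj m u; rewrite /= !dc -(c0 (m - 1 - 1)); apply/cP => A.
  by rewrite !evd diff_diff ev0.
pose QC := @Complex R Q (fun m => lin_of (dL m)) dd.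
exists QC, c; split.
  by split=> // m x; rewrite /= dc.
move=> A; pose h m (u : Q m) : X A m := ev A (s m u).
have hc m (x : T m) : h m (c m x) = ev A x by apply: csK.
have hL m : linear (h m).
  apply: linP => [u v|r u]; have [x <-] := c_surj m u.
    by have [y <-] := c_surj m v; rewrite -(cD m x y) !hc evD.
  by rewrite -(cZ m r x) !hc evZ.
have hd m (u : Q m) :
    lin_of (hL (m - 1)) (diff QC m u) = diff (X A) m (lin_of (hL m) u).
  by have [x <-] := c_surj m u; rewrite /= dc !hc evd.
exists (@ChainMap R QC (X A) (fun m => lin_of (hL m)) hd) => m x.
exact: hc.
Qed.

End TermComplex.

Lemma subcomplex_exists X (K : forall m, X m -> Prop) : subcomplex K ->
  exists (N : complex R) (i : chain_map N X),
    mono_map i /\ forall m (x : X m), im_map i x <-> K m x.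
Proof.
move=> [subK dK].
pose T m := {x | K m x}.
have [||||N [c [[c_surj cP _ _ _] h]]] := @term_complex_exists T
  (fun m => exist _ 0 (submodule0 (subK m)))
  (fun m u v => exist _ _ (submoduleD (subK m) (svalP u) (svalP v)))
  (fun m r u => exist _ _ (submoduleZ (subK m) r (svalP u)))
  (fun m u => exist _ _ (dK _ _ (svalP u))) unit (fun=> X)
  (fun _ m u => sval u) => //.
have [i iP] := h tt; exists N, i; split=> m x.
  have [u <-] := c_surj m x => y; have [v <-] := c_surj m y.
  by rewrite !iP => uv; apply/cP.
split=> [[y <-]|Kx]; last by exists (c m (exist _ x Kx)); rewrite iP.
by have [u <-] := c_surj m y; rewrite iP; apply: svalP.
Qed.

Section FreeComplex.
Variable G : int -> Type.

Inductive cterm : int -> Type :=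
| CGen m of G m : cterm m
| CZero m : cterm m
| CAdd m of cterm m & cterm m : cterm m
| CScale m of R & cterm m : cterm m
| CDiff m of cterm m : cterm (m - 1).

Record cinterp := Cinterp { ci_cx : complex R; ci_gen : forall m, G m -> ci_cx m }.

Fixpoint ceval (A : cinterp) m (t : cterm m) : ci_cx A m :=
  match t in cterm m return ci_cx A m with
  | CGen _ g => ci_gen A g
  | CZero _ => 0
  | CAdd _ t u => ceval A t + ceval A u
  | CScale _ r t => r *: ceval A t
  | CDiff _ t => diff (ci_cx A) _ (ceval A t)
  end.

Lemma free_complex_exists : exists (P : complex R) (g : forall m, G m -> P m),
  (forall X (a : forall m, G m -> X m),
     exists h : chain_map P X, forall m x, h m (g m x) = a m x) /\
  (forall X (h h' : chain_map P X),
     (forall m x, h m (g m x) = h' m (g m x)) -> forall m, h m =1 h' m).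
Proof.
have [||||P [c [[c_surj cP cD cZ cd] hP]]] := @term_complex_exists cterm
  CZero CAdd (fun m r t => CScale r t) CDiff cinterp ci_cx ceval => //.
exists P, (fun m x => c m (CGen x)); split=> [X a|X h h' hh' m u].
  by have [h hE] := hP (Cinterp a); exists h => m x; rewrite hE.
have [t <-] := c_surj m u.
elim: t => {m u} [m x|m|m t IHt u IHu|m r t IHt|m t IHt].
- exact: hh'.
- have e : c m (CZero m) = 0.
    apply: (@addrI _ (c m (CZero m))); rewrite -cD addr0.
    by apply/cP => A /=; rewrite addr0.
  by rewrite e !linear0.
- by rewrite cD !linearD IHt IHu.
- by rewrite cZ !linearZ IHt.
- by rewrite cd !cmap_diff IHt.
Qed.

End FreeComplex.

End ChainMaps.

(** * Extensions of complexes *)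

Section Extensions.
Variable R : pzRingType.
Implicit Types X Y Z E : complex R.

Lemma Ext1_zero_retract X Y : Ext1_zero X Y <->
  forall E (i : chain_map Y E) (p : chain_map E X), short_exact i p ->
  exists r : chain_map E Y, forall m y, r m (i m y) = y.
Proof.
split=> [extXY E i p ip|h [E i p ip]].
  have [h hP] := extXY (Extension ip).
  by exists (cm_comp (cm_fst Y X) h) => m y; apply: (congr1 fst ((hP m).1 y)).
have [r rP] := h E i p ip.
exists (cm_pair r p) => m; split=> [y|//] /=.
rewrite rP; congr pair; have [_ _ ex] := ip m.
by apply/ex; exists y.
Qed.

Section ShortExact.
Variables (Y E X : complex R) (i : chain_map Y E) (p : chain_map E X).
Hypothesis ip : short_exact i p.

Lemma short_exact_mono : mono_map i. Proof. by move=> m; case: (ip m). Qed.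
Lemma short_exact_epi : epi_map p. Proof. by move=> m; case: (ip m). Qed.
Lemma short_exactP m (e : E m) : ker_map p e <-> im_map i e.
Proof. by case: (ip m) => _ _; apply. Qed.
Lemma short_exact0 m (y : Y m) : p m (i m y) = 0.
Proof. by apply/short_exactP; exists y. Qed.

Lemma retract_of_section (s : chain_map X E) :
  (forall m x, p m (s m x) = x) ->
  exists r : chain_map E Y, forall m y, r m (i m y) = y.
Proof.
move=> sP.
have [|r rP] := map_factor_mono (f := cm_sub (cm_id E) (cm_comp s p))
  short_exact_mono.
  by move=> m e; apply/short_exactP; rewrite /ker_map /= linearB sP subrr.
exists r => m y; apply: (short_exact_mono (m := m)).
by rewrite rP /= short_exact0 linear0 subr0.
Qed.

End ShortExact.

Lemma mono_epi_short_exact Y E X (i : chain_map Y E) (p : chain_map E X) :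
  mono_map i -> epi_map p -> (forall m (e : E m), ker_map p e <-> im_map i e) ->
  short_exact i p.
Proof.
by move=> i_inj p_surj ipP m; split; [apply: i_inj|apply: p_surj|apply: ipP].
Qed.

Section Pushout.
Variables (X Y U V : complex R) (i : chain_map U V) (p : chain_map V X).
Variable g : chain_map U Y.
Hypothesis ip : short_exact i p.

Lemma pushout_exists : exists (L : complex R) (j : chain_map Y L)
    (k : chain_map V L) (o : chain_map L X),
  [/\ short_exact j o, forall m u, j m (g m u) = k m (i m u),
      forall m v, o m (k m v) = p m v,
      forall m (l : L m), exists y v, l = j m y + k m v &
      forall (W : complex R) (a : chain_map Y W) (b : chain_map V W),
        (forall m u, a m (g m u) = b m (i m u)) ->
        exists c : chain_map L W, (forall m y, c m (j m y) = a m y) /\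
          forall m v, c m (k m v) = b m v].
Proof.
(* The quotient of the sum of Y and V by the image of (-g, i). *)
have [L [q [q_surj qP]]] :=
  quotient_complex_exists (im_subcomplex (cm_pair (cm_sub (cm_zero U Y) g) i)).
pose j := cm_comp q (cm_pair (cm_id Y) (cm_zero Y V)).
pose k := cm_comp q (cm_pair (cm_zero V Y) (cm_id V)).
have qE m (y : Y m) (v : V m) : q m (y, v) = j m y + k m v.
  by rewrite /= -linearD; congr (q m _); congr pair; rewrite /= ?addr0 ?add0r.
have jk m (u : U m) : j m (g m u) = k m (i m u).
  apply/esym/subr0_eq; rewrite /= -linearB; apply/qP; exists u.
  by congr pair; rewrite /= ?subr0.
have qUP (W : complex R) (a : chain_map Y W) (b : chain_map V W) :
    (forall m u, a m (g m u) = b m (i m u)) ->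
    exists c : chain_map L W, (forall m y, c m (j m y) = a m y) /\
          forall m v, c m (k m v) = b m v.
  move=> ab.
  have dL m : linear (fun w : dsum V Y m => a m w.1 + b m w.2).
    by move=> r x y; rewrite !linearP scalerDr addrACA.
  have dd m (w : dsum V Y m) :
      a (m - 1) (diff Y m w.1) + b (m - 1) (diff V m w.2) =
      diff W m (a m w.1 + b m w.2).
    by rewrite linearD !cmap_diff.
  have [|c cP] := map_factor_epi (f := map_of dL dd) q_surj.
    move=> m w /qP[u <-]; rewrite /ker_map /=.
    by rewrite sub0r linearN ab addNr.
  exists c; split=> m y; rewrite /j /k [cm_comp _ _ _ _]/= cP /=.
    by rewrite linear0 addr0.
  by rewrite linear0 add0r.
have [|o [oj ok]] := qUP X (cm_zero Y X) p.
  by move=> m u; rewrite (short_exact0 ip).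
exists L, j, k, o; split=> // [|m l]; last first.
  by have [[y v] <-] := q_surj m l; exists y, v; rewrite qE.
apply: mono_epi_short_exact => m.
- move=> y y' /= e; apply/subr0_eq; move: e => /eqP.
  rewrite -subr_eq0 -linearB => /eqP/qP[u [/= gu iu]].
  have u0 : u = 0.
    by apply: (short_exact_mono ip (m := m)); rewrite iu subrr linear0.
  by rewrite -gu u0 linear0 subrr.
- move=> x; have [v <-] := short_exact_epi ip x.
  by exists (k m v); rewrite ok.
- move=> l; split=> [|[y <-]]; last by rewrite /ker_map oj.
  have [[y v] <-] := q_surj m l; rewrite qE /ker_map linearD oj ok add0r.
  move=> /(short_exactP ip)[u <-]; exists (y + g m u).
  by rewrite linearD jk.
Qed.

(** The obstruction to extending g is the class of its pushout extension; a retraction of the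
    pushout onto Y restricts to the extension. *)
Lemma Ext1_zero_extend : Ext1_zero X Y ->
  exists g' : chain_map V Y, forall m u, g' m (i m u) = g m u.
Proof.
have [L [j [k [o [jo jk _ _ _]]]]] := pushout_exists.
move=> /Ext1_zero_retract/(_ _ _ _ jo)[r rP].
by exists (cm_comp r k) => m u; rewrite /= -jk rP.
Qed.

End Pushout.

(** * Good subcomplexes and the Löwenheim-Skolem argument *)

(* The last clause makes both the subcomplex and the quotient exact when X is. *)
Definition good X (K : forall m, X m -> Prop) : Prop :=
  [/\ subcomplex K, forall m, pure (K m)
    & forall m (y : X m), K (m - 1) (diff X m y) ->
        exists2 y', K m y' & diff X m y' = diff X m y].

Lemma good_preimage X L (q : chain_map X L) (N : forall m, L m -> Prop) :
  epi_map q -> good (ker_map q) -> good N -> good (fun m x => N m (q m x)).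
Proof.
move=> q_surj [subK pureK divK] [[subN dN] pureN divN].
have pureQ m : pure (fun x => N m (q m x)) :=
  pure_preimage (q_surj m) (pureK m) (pureN m).
split=> [|//|m y].
  by split=> [m|m x Nx]; [case: (pureQ m)|rewrite cmap_diff; apply: dN].
rewrite cmap_diff => /divN[l Nl dl]; have [x xl] := q_surj m l.
(* The lift x may have the wrong boundary; the error is a boundary inside ker q, hence the boundary
   of an element of ker q. *)
have [|w Kw dw] := divK m (y - x).
  by rewrite /ker_map cmap_diff !linearB xl dl subrr.
exists (x + w); first by rewrite linearD Kw addr0 xl.
by rewrite linearD dw linearB [LHS]addrC subrK.
Qed.

Definition cprojective P : Prop :=
  forall X Y (q : chain_map X Y) (f : chain_map P Y), epi_map q ->
  exists g : chain_map P X, forall m x, q m (g m x) = f m x.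

Lemma free_cprojective (G : int -> Type) (P : complex R) (g : forall m, G m -> P m) :
  (forall X (a : forall m, G m -> X m),
     exists h : chain_map P X, forall m x, h m (g m x) = a m x) ->
  (forall X (h h' : chain_map P X),
     (forall m x, h m (g m x) = h' m (g m x)) -> forall m, h m =1 h' m) ->
  cprojective P.
Proof.
move=> Pex Puni X Y q f /family_choice[s sP].
have [h hP] := Pex X (fun m x => s m (f m (g m x))).
by exists h; apply: (Puni _ (cm_comp q h) f) => m x /=; rewrite hP sP.
Qed.

Lemma cover_exists X : exists (P : complex R) (p : chain_map P X),
  cprojective P /\ epi_map p.
Proof.
have [P [g [Pex Puni]]] := free_complex_exists R (fun m => X m).
have [p pP] := Pex X (fun m x => x).
exists P, p; split; first exact: free_cprojective Pex Puni.
by move=> m x; exists (g m x).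
Qed.

(* Names for the elements of the smallest good subcomplex containing one given
   element in each degree; they do not depend on the ambient complex. *)
Inductive lterm : int -> Type :=
| LGen m : lterm m
| LZero m : lterm m
| LAdd m of lterm m & lterm m : lterm m
| LScale m of R & lterm m : lterm m
| LDiff m of lterm m : lterm (m - 1)
| LPre m of lterm (m - 1) : lterm m
| LSol m of seq (seq (R * nat)) & (nat -> lterm m) & nat : lterm m.

Section LowenheimSkolem.
Variables (X : complex R) (x : forall m, X m).

Definition solution m (sys : seq (seq (R * nat))) (c : nat -> X m)
    (v : nat -> X m) : Prop :=
  forall k, (k < size sys)%N -> lsum (nth [::] sys k) v = c k.

Definition some_such (A : Type) (a : A) (P : A -> Prop) : A :=
  if pselect (exists y, P y) is left h then sval (cid h) else a.

Lemma some_suchP (A : Type) (a : A) (P : A -> Prop) :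
  (exists y, P y) -> P (some_such a P).
Proof. by rewrite /some_such; case: pselect => // h _; apply: svalP. Qed.

(** Names of preimages and solutions that do not exist evaluate to 0; goodness only concerns those
    that exist. *)
Fixpoint leval m (t : lterm m) : X m :=
  match t in lterm m return X m with
  | LGen m => x m
  | LZero m => 0
  | LAdd _ t u => leval t + leval u
  | LScale _ r t => r *: leval t
  | LDiff m t => diff X m (leval t)
  | LPre m t => some_such 0 (fun y => diff X m y = leval t)
  | LSol m sys c i => some_such (fun=> 0) (solution sys (fun k => leval (c k))) i
  end.

Definition named m (y : X m) : Prop := exists t, @leval m t = y.

Lemma named_subcomplex : subcomplex named.
Proof.
split=> [m|m _ [t <-]]; last by exists (LDiff t).
split=> [|r _ _ [t <-] [u <-]]; first by exists (LZero m).
by exists (LAdd (LScale r t) u).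
Qed.

Lemma named_good : good named.
Proof.
split=> [|m|m y [t ty]]; first exact: named_subcomplex.
  split=> [|sys v Nv]; first by case: named_subcomplex.
  have /choice[c cP] k : exists t, (k < size sys)%N ->
      @leval m t = lsum (nth [::] sys k) v.
    case: ltnP => [ks|_]; last by exists (LZero m).
    by have [t <-] := Nv _ (mem_nth [::] ks); exists t.
  exists (fun i => leval (LSol sys c i)); split=> [i|e].
    by exists (LSol sys c i).
  move=> /(nthP [::])[k ks <-] /=.
  have [|sol] := pselect (exists v, solution sys (fun k => leval (c k)) v).
    move=> /(some_suchP (fun=> 0)) /(_ k ks) sol.
    by rewrite -(cP k ks) -sol.
  by case: sol; exists v => k' /cP ->.
exists (leval (LPre t)); first by exists (LPre t).
rewrite -ty /=; apply: (@some_suchP _ 0 (fun z => diff X m z = leval t)).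
by exists y.
Qed.

End LowenheimSkolem.

(** P is free on the names. The map sending each name to its value has the named subcomplex as its
    image: it hits every value, and by uniqueness on generators it factors through that
    subcomplex. *)
Lemma lowenheim_skolem : exists P : complex R, cprojective P /\
  forall X (x : forall m, X m), exists f : chain_map P X,
    good (im_map f) /\ forall m, im_map f (x m).
Proof.
have [P [g [Pex Puni]]] := free_complex_exists R lterm.
exists P; split=> [|X x]; first exact: free_cprojective Pex Puni.
have [f fP] := Pex X (@leval X x).
exists f; suff -> : im_map f = @named X x.
  by split=> [|m]; [apply: named_good|exists (LGen m)].
apply: functional_extensionality_dep => m; apply: funext => y.
apply: propext; split=> [[u <-]|[t <-]]; last by exists (g m t).
have [N [i [i_inj iP]]] := subcomplex_exists (named_subcomplex x).
have /family_choice[n nP] : forall m (t : lterm m), exists y, i m y = leval x t.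
  by move=> m' t; apply/iP; exists t.
have [f' f'P] := Pex N n.
have ff' : forall m, f m =1 cm_comp i f' m.
  by apply: Puni => m' t; rewrite /= fP f'P nP.
by rewrite ff'; apply/iP; exists (f' m u).
Qed.

End Extensions.

(** * The small object argument *)

Section InjectiveModule.
Variable R : pzRingType.

Definition linear_on (M N : lmodType R) (K : M -> Prop) (f : M -> N) : Prop :=
  forall r x y, K x -> K y -> f (r *: x + y) = r *: f x + f y.

Definition injective_module (I : lmodType R) : Prop :=
  forall (M : lmodType R) (K : M -> Prop) (f : M -> I),
    submodule K -> linear_on K f ->
  exists g : {linear M -> I}, forall x, K x -> g x = f x.

(* The character module of R. *)
Lemma injective_cogenerator_exists : exists I : lmodType R,
  injective_module I /\
  forall (M : lmodType R) (K : M -> Prop) x, submodule K -> ~ K x ->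
  exists g : {linear M -> I}, (forall y, K y -> g y = 0) /\ g x <> 0.
Proof.
pose A : lmodType R^c := (R^c)^o.
have [I [e [be fullI sepI]]] := left_character_exists A.
have eA (a : R) c : e (a : A) c = e (1 : A) (a *: c).
  by rewrite -(balZ be) /= -[in LHS](mulr1 (a : R^c)).
(* Linear maps into the character module of R correspond to additive maps into [QZ]. *)
have lin_ext (M : lmodType R) (chi : {additive M -> QZ}) :
    exists g : {linear M -> I}, forall (a : R) x, e (a : A) (g x) = chi (a *: x).
  have bt : balanced (fun (a : A) (x : M) => chi ((a : R) *: x)).
    split=> [a b x|a x y|a r x]; first by rewrite scalerDl raddfD.
      by rewrite scalerDr raddfD.
    by rewrite scalerA.
  have [g gP] := bal_left_char bt be fullI sepI.
  by exists g => a x; rewrite gP.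
exists I; split=> [M K f subK fL|M K x subK nKx].
  have fB x y : K x -> K y -> f (x - y) = f x - f y.
    by move=> Kx Ky; rewrite addrC -scaleN1r fL // scaleN1r addrC.
  have fZ r x : K x -> f (r *: x) = r *: f x.
    move=> Kx; have K0 := submodule0 subK.
    have f0 : f 0 = 0 by rewrite -(subrr 0) fB // subrr.
    by rewrite -[r *: x]addr0 fL // f0 addr0.
  have [||x y Kx Ky|chi chiP] := @QZ_extends M K (fun x => e (1 : A) (f x)).
  - exact: submodule0.
  - by move=> x y; apply: submoduleB.
  - by rewrite fB // (balBr be).
  have [g gP] := lin_ext M chi; exists g => x Kx; apply: sepI => a.
  by rewrite gP chiP; [rewrite fZ // -eA|apply: submoduleZ].
have [L [q [q_surj qP]]] := quotient_exists subK.
have [chi chix] := @QZ_cogenerator _ (q x) (fun qx => nKx ((qP x).1 qx)).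
have [g gP] := lin_ext L chi.
exists (g \o q); split=> [y /qP qy /=|/= gqx].
  by rewrite qy linear0.
by apply: chix; rewrite -[q x]scale1r -gP gqx (bal0r be).
Qed.

End InjectiveModule.

Section Disk.
Variables (R : pzRingType) (Y : lmodType R).

(* The product of the disk complexes on Y in all degrees. *)
Definition disk_diff (u : (Y * Y)%type) : (Y * Y)%type := (u.2, 0).

Lemma disk_diff_linear : linear disk_diff.
Proof. by move=> r u v; congr pair; rewrite /= scaler0 addr0. Qed.

Definition disk : complex R :=
  @Complex R (fun=> (Y * Y)%type : lmodType R) (fun=> lin_of disk_diff_linear)
    (fun _ _ => erefl).

(** Any family of linear maps to Y is the first component of a chain map, and it determines the
    second. *)
Lemma disk_map_exists (X : complex R) (a : forall m, {linear X m -> Y}) :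
  exists f : chain_map X disk,
    forall m x, f m x = (a m x, a (m - 1) (diff X m x)).
Proof.
pose f m (x : X m) : disk m := (a m x, a (m - 1) (diff X m x)).
have fL m : linear (f m) by move=> r x y; rewrite /f !linearP.
have fd m x : f (m - 1) (diff X m x) = diff disk m (f m x).
  by rewrite /f diff_diff linear0.
by exists (map_of fL fd).
Qed.

Lemma disk_map_fst (X : complex R) (f : chain_map X disk) m :
  exists a : {linear X m -> Y}, forall x, a x = (f m x).1.
Proof.
have L : linear (fun x => (f m x).1) by move=> r x y; rewrite linearP.
by exists (lin_of L).
Qed.

End Disk.

Section SmallObject.
Variables (R : pzRingType) (C : complex_class R) (P : complex R).
Hypothesis projP : cprojective P.
Hypothesis skolemP : forall (X : complex R) (x : forall m, X m),
  exists f : chain_map P X, good (im_map f) /\ forall m, im_map f (x m).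
Hypothesis C_good_sub : forall (N X : complex R) (i : chain_map N X),
  C X -> mono_map i -> good (im_map i) -> C N.
Hypothesis C_good_quotient : forall (X L : complex R) (q : chain_map X L),
  C X -> epi_map q -> good (ker_map q) -> C L.
Hypothesis C_left_orth : forall Z, left_orth (right_orth C) Z -> C Z.

(** As subobjects of one complex, these kernels stand in for a set of representatives. [sm_quo]
    speaks of every model of P / K, so that none has to be chosen. *)
Record small := Small {
  sm_ker : forall m, P m -> Prop;
  sm_sub : subcomplex sm_ker;
  sm_quo : forall (L : complex R) (q : chain_map P L), epi_map q ->
    (forall m (x : P m), ker_map q x <-> sm_ker x) -> C L
}.

Definition chain_on (K : forall m, P m -> Prop) (M : complex R)
    (f : forall m, P m -> M m) : Prop :=
  (forall m, linear_on (@K m) (f m)) /\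
  forall m x, K m x -> f (m - 1) (diff P m x) = diff M m (f m x).

Definition extends_small (M : complex R) : Prop :=
  forall (s : small) (f : forall m, P m -> M m), chain_on (@sm_ker s) f ->
  exists g : chain_map P M, forall m x, sm_ker s x -> g m x = f m x.

Lemma right_orth_extends_small Y : right_orth C Y -> extends_small Y.
Proof.
move=> CY s f [fL fd].
have [N [i [i_inj iP]]] := subcomplex_exists (sm_sub s).
have [L [q [q_surj qP]]] := quotient_complex_exists (sm_sub s).
have iq : short_exact i q.
  apply: mono_epi_short_exact => // m x; split=> [/qP/iP//|/iP/qP//].
have Ki m (u : N m) : sm_ker s (i m u) by apply/iP; exists u.
have gL m : linear (fun u => f m (i m u)).
  by move=> r u v; rewrite linearP fL.
have gd m (u : N m) :
    f (m - 1) (i (m - 1) (diff N m u)) = diff Y m (f m (i m u)).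
  by rewrite cmap_diff fd.
have [g' g'P] := Ext1_zero_extend (map_of gL gd) iq (CY _ (sm_quo q_surj qP)).
by exists g' => m x /iP[u <-]; rewrite g'P.
Qed.

(** * Splitting extensions of objects of C by Zorn's lemma *)

Section PartialSections.
Variables (X Y E : complex R) (i : chain_map Y E) (p : chain_map E X).
Hypotheses (CX : C X) (extY : extends_small Y) (ip : short_exact i p).

(** A graded subset is encoded as one predicate on the disjoint union of the degrees, the form to
    which [zorn_above] applies. *)
Let slice (G : {m & E m} -> Prop) m (e : E m) : Prop := G (existT _ m e).
Let dom (G : {m & E m} -> Prop) m (x : X m) : Prop :=
  exists2 e, slice G e & p m e = x.

(* A section of p over a good subcomplex of X, given by its image in E. *)
Let partial_section (G : {m & E m} -> Prop) : Prop :=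
  [/\ subcomplex (@slice G), forall m (e : E m), slice G e -> p m e = 0 -> e = 0
    & good (dom G)].

Let dom_submodule G m : submodule (@slice G m) -> submodule (@dom G m).
Proof.
move=> subG; split; first by exists 0; [apply: submodule0|rewrite linear0].
move=> r _ _ [d Gd <-] [e Ge <-]; exists (r *: d + e); last by rewrite linearP.
exact: (proj2 subG).
Qed.

Let partial_section0 : partial_section (fun t => projT2 t = 0).
Proof.
have sl0 m (e : E m) : slice (fun t => projT2 t = 0) e -> e = 0 by [].
have sub0 : subcomplex (@slice (fun t => projT2 t = 0)).
  split=> [m|m x /sl0 ->]; last exact: linear0.
  by split=> // r x y /sl0 -> /sl0 ->; rewrite scaler0 addr0.
have dom0 m (x : X m) : dom (fun t => projT2 t = 0) x <-> x = 0.
  by split=> [[e /sl0 -> <-]|->]; [rewrite linear0|exists 0; rewrite ?linear0].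
split=> //; split=> [|m|m y /dom0 dy].
- split=> [m|m x [e /sl0 -> <-]]; first by apply: dom_submodule; case: sub0.
  by apply/dom0; rewrite !linear0.
- split=> [|sys v v0]; first by apply: dom_submodule; case: sub0.
  exists (fun=> 0); split=> [_|e /v0/dom0 ->]; first exact/dom0.
  by rewrite /lsum big1 // => q _; rewrite scaler0.
- by exists 0; [apply/dom0|rewrite dy linear0].
Qed.

Let partial_section_union (F : ({m & E m} -> Prop) -> Prop) :
  (exists A, F A) -> (forall A, F A -> partial_section A) ->
  (forall A B, F A -> F B ->
     (forall t, A t -> B t) \/ (forall t, B t -> A t)) ->
  partial_section (fun t => exists2 A, F A & A t).
Proof.
move=> [A0 FA0] FP Ftot; set U := fun t => _.
have UA A : F A -> forall m x, @dom A m x -> dom U x.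
  by move=> FA m x [e Ae <-]; exists e => //; exists A.
have subU : subcomplex (@slice U).
  split=> [m|m e [A FA Ae]]; last first.
    by exists A => //; have [[_ dA] _ _] := FP _ FA; apply: dA.
  split; first by exists A0 => //; have [[sA _] _ _] := FP _ FA0; case: (sA m).
  move=> r x y [A FA Ax] [B FB By]; have [AB|BA] := Ftot _ _ FA FB.
    exists B => //; have [[sB _] _ _] := FP _ FB.
    by apply: (proj2 (sB m)) => //; apply: AB.
  exists A => //; have [[sA _] _ _] := FP _ FA.
  by apply: (proj2 (sA m)) => //; apply: BA.
split=> // [m e [A FA Ae]|]; first by have [_ + _] := FP _ FA; apply.
split=> [|m|m y [e [A FA Ae] ey]].
- split=> [m|m x [e [A FA Ae] <-]]; first by apply: dom_submodule; case: subU.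
  apply: (UA A FA); rewrite -cmap_diff; exists (diff E m e) => //.
  by have [[_ dA] _ _] := FP _ FA; apply: dA.
- split=> [|sys v Uv]; first by apply: dom_submodule; case: subU.
  (* The finitely many constants of the system lie in the domain of a single member of the chain. *)
  have [A FA Av] : exists2 A, F A &
      forall e : seq (R * nat), e \in sys -> @dom A m (lsum e v).
    elim: sys Uv => [|e sys IHsys] Uv; first by exists A0.
    have [|A FA Av] := IHsys.
      by move=> d d_sys; apply: Uv; rewrite inE d_sys orbT.
    have [d [B FB Bd] dE] := Uv e (mem_head _ _).
    have [AB|BA] := Ftot _ _ FA FB; [exists B|exists A] => // e'.
      rewrite inE => /orP[/eqP ->|/Av[d' Ad' d'E]]; first by exists d.
      by exists d' => //; apply: AB.
    rewrite inE => /orP[/eqP ->|/Av//]; exists d => //; exact: BA.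
  have [_ _ [_ pA _]] := FP _ FA; have [_ /(_ _ _ Av)[v' [Av' v'P]]] := pA m.
  by exists v'; split=> // k; apply: (UA A FA).
- have [_ _ [_ _ divA]] := FP _ FA.
  have [|y' Ay' <-] := divA m y; first by exists e.
  by exists y' => //; apply: (UA A FA).
Qed.

(** The section is extended over the preimage of a small good subcomplex of L = X / dom G that
    contains the class of x0. That subcomplex is P / ker f and lies in C, so the obstruction, a map
    ker f -> Y, extends to P. *)
Let partial_section_extend G m0 (x0 : X m0) : partial_section G -> ~ dom G x0 ->
  exists2 G', partial_section G' & (forall t, G t -> G' t) /\ dom G' x0.
Proof.
move=> [[subG dG] G0 goodG] nGx0.
have subD : subcomplex (@dom G) by case: goodG.
have [L [q [q_surj qP]]] := quotient_complex_exists subD.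
have kerq : good (ker_map q).
  suff -> : ker_map q = @dom G by [].
  apply: functional_extensionality_dep => m; apply: funext => x.
  by apply: propext; apply: qP.
have CL := C_good_quotient CX q_surj kerq.
have [f [goodf fx]] := skolemP (@dfwith _ _ (fun m => 0 : L m) m0 (q m0 x0)).
have fx0 : im_map f (q m0 x0) by have := fx m0; rewrite dfwith_in.
have smf (L' : complex R) (q' : chain_map P L') : epi_map q' ->
    (forall m (x : P m), ker_map q' x <-> ker_map f x) -> C L'.
  move=> q'_surj q'P.
  have [m x /q'P//|k kP] := map_factor_epi (f := f) q'_surj.
  apply: (C_good_sub CL (i := k)).
    move=> m y y'; have [x <-] := q'_surj m y; have [x' <-] := q'_surj m y'.
    rewrite !kP => fxx'; apply/subr0_eq; rewrite -linearB; apply/q'P.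
    by rewrite /ker_map linearB fxx' subrr.
  suff -> : im_map k = im_map f by [].
  apply: functional_extensionality_dep => m; apply: funext => y.
  apply: propext; split=> [[y' <-]|[x <-]]; last by exists (q' m x).
  by have [x <-] := q'_surj m y'; exists x.
(* Projectivity of P lifts f to X and then to E. *)
have [la laP] := projP f q_surj.
have [mu muP] := projP la (short_exact_epi ip).
(* On ker f the map [la] lands in the domain of G, so [mu] differs there from the section by an
   element of Y; the value 0 off ker f is arbitrary. *)
have /family_choice[phi phiP] : forall m (u : P m), exists y, ker_map f u ->
    exists2 e, slice G e & p m e = la m u /\ i m y = mu m u - e.
  move=> m u; have [fu|nfu] := pselect (ker_map f u); last by exists 0.
  have /qP[e Ge ela] : ker_map q (la m u) by rewrite /ker_map laP.
  have /(short_exactP ip)[y yE] : ker_map p (mu m u - e).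
    by rewrite /ker_map linearB muP ela subrr.
  by exists y => _; exists e.
have i_inj := short_exact_mono ip.
pose s := Small (ker_subcomplex f) smf.
have phi_chain : chain_on (@sm_ker s) phi.
  split=> [m r u v fu fv|m u fu].
    have fuv : ker_map f (r *: u + v).
      by rewrite /ker_map linearP fu fv scaler0 addr0.
    have [e Ge [pe ie]] := phiP _ _ fuv.
    have [d Gd [pd id]] := phiP _ _ fu; have [c Gc [pc ic]] := phiP _ _ fv.
    apply: (i_inj m); rewrite linearP ie id ic.
    have -> : e = r *: d + c.
      apply/subr0_eq/G0; last by rewrite linearB linearP pe pd pc linearP subrr.
      by apply: submoduleB => //; apply: (proj2 (subG m)).
    by rewrite linearP scalerBr opprD addrACA.
  have fdu : ker_map f (diff P m u).
    by rewrite /ker_map cmap_diff fu linear0.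
  have [e Ge [pe ie]] := phiP _ _ fdu; have [d Gd [pd id]] := phiP _ _ fu.
  apply: (i_inj (m - 1)); rewrite ie !cmap_diff id linearB; congr (_ - _).
  apply/subr0_eq/G0; first by apply: submoduleB => //; apply: dG.
  by rewrite linearB pe !cmap_diff pd subrr.
have [theta thetaP] := extY phi_chain.
have [nu nuE nuG] : exists2 nu : chain_map P E,
    forall m u, p m (nu m u) = la m u &
    forall m (u : P m), ker_map f u -> slice G (nu m u).
  exists (cm_sub mu (cm_comp i theta)) => m u.
    by rewrite /= linearB muP (short_exact0 ip) subr0.
  move=> fu; have [e Ge [_ ie]] := phiP _ _ fu.
  by rewrite /= thetaP // ie opprB addrC subrK.
(* The sum of G and the image of [nu]. *)
pose G' (t : {m & E m}) :=
  exists2 g, slice G g & exists u, projT2 t = g + nu (tag t) u.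
have domG' : @dom G' = (fun m x => im_map f (q m x)).
  apply: functional_extensionality_dep => m; apply: funext => x.
  apply: propext; split=> [[e [g Gg [u /= ->]] <-]|[u fu]].
    exists u; rewrite -laP -nuE linearD linearD.
    suff -> : q m (p m g) = 0 by rewrite add0r.
    by apply/qP; exists g.
  have /qP[g Gg gx] : ker_map q (x - la m u).
    by rewrite /ker_map linearB laP fu subrr.
  exists (g + nu m u); first by exists g => //; exists u.
  by rewrite linearD gx nuE subrK.
exists G'; last split.
- split.
  + split=> [m|m e [g Gg [u /= ->]]]; last first.
      exists (diff E m g); first exact: dG.
      by exists (diff P m u); rewrite /= cmap_diff linearD.
    split; first by exists 0; [apply: submodule0|exists 0; rewrite linear0 addr0].
    move=> r e e' [g Gg [u /= ->]] [h Gh [v /= ->]].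
    exists (r *: g + h); first exact: (proj2 (subG m)).
    exists (r *: u + v); rewrite (linearP (nu m)) scalerDr.
    by rewrite addrACA.
  (* If p kills g + nu u, then la u lies in the domain of G, so f u = 0 and nu u is already in G. *)
  + move=> m e [g Gg [u /= ->]] pgu; apply: G0 => //.
    apply: submoduleD => //; apply: nuG; rewrite /ker_map -laP -nuE.
    have -> : p m (nu m u) = - p m g.
      by apply/eqP; rewrite -addr_eq0 addrC -linearD pgu.
    by rewrite linearN (_ : q m (p m g) = 0) ?oppr0 //; apply/qP; exists g.
  + rewrite domG'; exact: (good_preimage q_surj kerq goodf).
- case=> m e Ge; exists e => //; exists 0.
  by rewrite linear0 addr0.
- by rewrite domG'.
Qed.

Lemma partial_sections_total : exists r : chain_map E Y, forall m y, r m (i m y) = y.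
Proof.
have [G [PG _ Gmax]] := zorn_above partial_section0 partial_section_union.
have tot m (x : X m) : dom G x.
  apply: contrapT => nGx.
  have [G' PG' [GG' [e G'e ex]]] := partial_section_extend PG nGx.
  by apply: nGx; exists e => //; apply: (Gmax _ PG' GG').
have [[subG dG] G0 _] := PG.
have /family_choice[s sP] : forall m (x : X m), exists e, slice G e /\ p m e = x.
  by move=> m x; have [e Ge ex] := tot m x; exists e.
have sE m (e : E m) (x : X m) : slice G e -> p m e = x -> s m x = e.
  move=> Ge ex; have [Gs sx] := sP m x.
  by apply/subr0_eq/G0; [apply: submoduleB|rewrite linearB sx ex subrr].
have sL m : linear (s m).
  move=> r x y; have [Gx px] := sP m x; have [Gy py] := sP m y.
  by apply: sE; [apply: (proj2 (subG m))|rewrite linearP px py].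
have sd m x : s (m - 1) (diff X m x) = diff E m (s m x).
  have [Gx px] := sP m x.
  by apply: sE; [apply: dG|rewrite cmap_diff px].
apply: (retract_of_section ip (s := map_of sL sd)) => m x.
by case: (sP m x).
Qed.

End PartialSections.

Lemma extends_small_right_orth Y : extends_small Y -> right_orth C Y.
Proof.
move=> extY X CX; apply/Ext1_zero_retract => E i p ip.
exact: partial_sections_total CX extY ip.
Qed.

(** * The envelope of Z as an initial algebra *)

Section Envelope.
Variable Z : complex R.

(** Solutions are a chosen operation rather than a property, so that there can be an initial
    structure. On families that are not chain maps on the kernel, [al_solve] is unconstrained, and
    [algebra_map] ignores it. *)
Record algebra := Algebra {
  al_cx :> complex R;
  al_unit : chain_map Z al_cx;
  al_solve : small -> (forall m, P m -> al_cx m) -> chain_map P al_cx;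
  al_solveP : forall s f, chain_on (@sm_ker s) f ->
    forall m x, sm_ker s x -> al_solve s f m x = f m x
}.
Arguments al_solve : clear implicits.
Arguments al_unit : clear implicits.

Definition algebra_map (A B : algebra) (h : chain_map A B) : Prop :=
  (forall m z, h m (al_unit A m z) = al_unit B m z) /\
  forall s (f : forall m, P m -> A m), chain_on (@sm_ker s) f ->
    forall m x,
      h m (al_solve A s f m x) = al_solve B s (fun m x => h m (f m x)) m x.

Lemma chain_on_map (s : small) (A B : complex R) (h : chain_map A B)
    (f : forall m, P m -> A m) :
  chain_on (@sm_ker s) f -> chain_on (@sm_ker s) (fun m x => h m (f m x)).
Proof.
move=> [fL fd]; split=> [m r x y Kx Ky|m x Kx]; first by rewrite fL // linearP.
by rewrite fd // cmap_diff.
Qed.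

(* Well-founded trees replace the transfinite iteration of the small object
   argument: TSol formally solves the extension problem posed by a family of
   terms, and is admissible (see twf) if the problem makes sense in every
   algebra. *)
Inductive aterm : int -> Type :=
| TUnit m of Z m : aterm m
| TZero m : aterm m
| TAdd m of aterm m & aterm m : aterm m
| TScale m of R & aterm m : aterm m
| TDiff m of aterm m : aterm (m - 1)
| TSol m (s : small) of (forall k, P k -> aterm k) & P m : aterm m.

Fixpoint teval (A : algebra) m (t : aterm m) : A m :=
  match t in aterm m return A m with
  | TUnit m z => al_unit A m z
  | TZero _ => 0
  | TAdd _ t u => teval A t + teval A u
  | TScale _ r t => r *: teval A t
  | TDiff m t => diff A m (teval A t)
  | TSol m s f x => al_solve A s (fun k y => teval A (f k y)) m x
  end.

Fixpoint twf m (t : aterm m) : Prop :=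
  match t with
  | TUnit _ _ | TZero _ => True
  | TAdd _ t u => twf t /\ twf u
  | TScale _ _ t => twf t
  | TDiff _ t => twf t
  | TSol _ s f _ => (forall k y, twf (f k y)) /\
      forall A : algebra, chain_on (@sm_ker s) (fun k y => teval A (f k y))
  end.

Let wterm m := {t : aterm m | twf t}.

(** Equality in B can be tested in every algebra ([hI]), so B inherits linearity and the solution
    property from all of them. Uniqueness is by induction on terms. *)
Lemma initial_algebra_exists : exists (B : algebra)
    (h : forall A : algebra, chain_map B A),
  (forall A, algebra_map (h A)) /\
  forall (A : algebra) (k : chain_map B A), algebra_map k ->
    forall m x, k m x = h A m x.
Proof.
have [||||B [c [[c_surj cP cD cZ cd] hex]]] := @term_complex_exists R wterm
  (fun m => exist _ (TZero m) I)
  (fun m u v => exist _ (TAdd (sval u) (sval v)) (conj (svalP u) (svalP v)))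
  (fun m r u => exist _ (TScale r (sval u)) (svalP u))
  (fun m u => exist _ (TDiff (sval u)) (svalP u))
  algebra al_cx (fun A m u => teval A (sval u)) => //.
pose h A : chain_map B (al_cx A) := sval (cid (hex A)).
have hP A m (u : wterm m) : h A m (c m u) = teval A (sval u).
  by rewrite /h; case: cid.
have hI m (x y : B m) : (forall A, h A m x = h A m y) -> x = y.
  have [u <-] := c_surj m x; have [v <-] := c_surj m y.
  by move=> huv; apply/cP => A; rewrite -!hP; apply: huv.
have uL m : linear (fun z : Z m => c m (exist _ (TUnit z) I)).
  by move=> r x y; apply: hI => A; rewrite linearP !hP /= linearP.
have ud m (z : Z m) : c (m - 1) (exist _ (TUnit (diff Z m z)) I) =
    diff B m (c m (exist _ (TUnit z) I)).
  by apply: hI => A; rewrite cmap_diff !hP /= cmap_diff.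
have solP s (f : forall m, P m -> B m) : exists g : chain_map P B,
    chain_on (@sm_ker s) f -> forall A m x,
    h A m (g m x) = al_solve A s (fun k y => h A k (f k y)) m x.
  have [chf|nch] := pselect (chain_on (@sm_ker s) f); last first.
    by exists (cm_zero P B).
  have /family_choice[t tP] : forall k (y : P k), exists u : wterm k, c k u = f k y.
    by move=> k y; apply: c_surj.
  have tE A : (fun k y => teval A (sval (t k y))) = (fun k y => h A k (f k y)).
    apply: functional_extensionality_dep => k; apply: funext => y.
    by rewrite -tP hP.
  (* The terms name the values of f, which is a chain map on the kernel in B, hence in every algebra
     through [h A]. *)
  have w m (x : P m) : twf (TSol s (fun k y => sval (t k y)) x).
    split=> [k y|A]; first by apply: svalP.
    by rewrite tE; apply: chain_on_map.
  pose g m (x : P m) := c m (exist _ _ (w m x)).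
  have gE A m x : h A m (g m x) = al_solve A s (fun k y => h A k (f k y)) m x.
    by rewrite /g hP /= tE.
  have gL m : linear (g m).
    by move=> r x y; apply: hI => A; rewrite linearP !gE linearP.
  have gd m (x : P m) : g (m - 1) (diff P m x) = diff B m (g m x).
    by apply: hI => A; rewrite cmap_diff !gE cmap_diff.
  by exists (map_of gL gd) => _ A m x; apply: gE.
have sol s f := cid (solP s f).
have solK s f : chain_on (@sm_ker s) f ->
    forall m x, sm_ker s x -> sval (sol s f) m x = f m x.
  move=> chf m x Kx; apply: hI => A; rewrite (svalP (sol s f)) //.
  by rewrite (al_solveP (chain_on_map (h A) chf)).
pose BA := @Algebra B (map_of uL ud) (fun s f => sval (sol s f)) solK.
exists BA, h; split=> [A|A k [ku ks] m x].
  split=> [m z|s f chf m x]; first by rewrite hP.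
  by rewrite (svalP (sol s f)).
have [[t w] <-] := c_surj m x; rewrite hP /=.
elim: t w => {m x} [m z|m|m t IHt u IHu|m r t IHt|m t IHt|m s f IHf x] w.
- by rewrite /= -ku; congr (k m _); apply: hI => A'; rewrite !hP.
- have -> : c m (exist _ (TZero m) w) = 0.
    by apply: hI => A'; rewrite hP linear0.
  exact: linear0.
- have [wt wu] := w.
  have -> : c m (exist _ (TAdd t u) w) = c m (exist _ t wt) + c m (exist _ u wu).
    by apply: hI => A'; rewrite linearD !hP.
  by rewrite linearD IHt IHu.
- have -> : c m (exist _ (TScale r t) w) = r *: c m (exist _ t w).
    by apply: hI => A'; rewrite linearZ /= !hP.
  by rewrite linearZ /= IHt.
- have -> : c (m - 1) (exist _ (TDiff t) w) = diff B m (c m (exist _ t w)).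
    by apply: hI => A'; rewrite cmap_diff !hP.
  by rewrite cmap_diff IHt.
- have [wf wch] := w; pose F k y : B k := c k (exist _ (f k y) (wf k y)).
  have chF : chain_on (@sm_ker s) F.
    split=> [n r a b Ka Kb|n a Ka]; apply: hI => A'.
      by rewrite linearP !hP; apply: (proj1 (wch A')).
    by rewrite cmap_diff !hP; apply: (proj2 (wch A')).
  have -> : c m (exist _ (TSol s f x) w) = al_solve BA s F m x.
    apply: hI => A'; rewrite hP [RHS](svalP (sol s F)) //=.
    congr (al_solve A' s _ m x); apply: functional_extensionality_dep => n.
    by apply: funext => y; rewrite hP.
  rewrite ks //=; congr (al_solve A s _ m x).
  by apply: functional_extensionality_dep => n; apply: funext => y; apply: IHf.
Qed.

(** For the lifting property, the pullback of E and B over W is made an algebra whose solutions lie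
    over those of B. Initiality maps B to it, and projecting to E gives the lift. *)
Lemma envelope_exists : exists (B : complex R) (u : chain_map Z B),
  right_orth C B /\
  (forall (M : complex R) (f : chain_map Z M), extends_small M ->
     exists g : chain_map B M, forall m z, g m (u m z) = f m z) /\
  forall (Y E W : complex R) (j : chain_map Y E) (q : chain_map E W)
    (a : chain_map Z E) (b : chain_map B W),
    short_exact j q -> right_orth C Y ->
    (forall m z, q m (a m z) = b m (u m z)) ->
  exists v : chain_map B E, (forall m z, v m (u m z) = a m z) /\
    forall m x, q m (v m x) = b m x.
Proof.
have [B [h [hA huni]]] := initial_algebra_exists.
have hid m x : h B m x = x.
  by have := huni B (cm_id B) (conj (fun _ _ => erefl) (fun _ _ _ _ _ => erefl)) m x.
exists B, (al_unit B); split; [|split].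
- apply: extends_small_right_orth => s f chf.
  by exists (al_solve B s f); apply: al_solveP.
- move=> M f extM.
  have solM s (F : forall m, P m -> M m) : exists g : chain_map P M,
      chain_on (@sm_ker s) F -> forall m x, sm_ker s x -> g m x = F m x.
    have [chF|nch] := pselect (chain_on (@sm_ker s) F).
      by have [g gP] := extM s F chF; exists g.
    by exists (cm_zero P M).
  pose A := @Algebra M f (fun s F => sval (cid (solM s F)))
    (fun s F => svalP (cid (solM s F))).
  by exists (h A); case: (hA A).
- move=> Y E W j q a b jq CY qa.
  pose psi : chain_map (dsum B E) W :=
    cm_sub (cm_comp q (cm_fst E B)) (cm_comp b (dsum_out B E)).
  have [E' [inc [inc_inj incP]]] := subcomplex_exists (ker_subcomplex psi).
  pose pe := cm_comp (cm_fst E B) inc; pose pb := cm_comp (dsum_out B E) inc.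
  have incE m (x : E' m) : inc m x = (pe m x, pb m x).
    by rewrite /pe /pb /=; case: (inc m x).
  have qpe m (x : E' m) : q m (pe m x) = b m (pb m x).
    by apply/subr0_eq; apply/(incP m (inc m x)); exists x.
  have pairE (V : complex R) (f : chain_map V E) (g : chain_map V B) :
      (forall m x, q m (f m x) = b m (g m x)) ->
      exists k : chain_map V E', forall m x,
        pe m (k m x) = f m x /\ pb m (k m x) = g m x.
    move=> fg; have [|k kP] := map_factor_mono (f := cm_pair f g) inc_inj.
      by move=> m x; apply/incP; rewrite /ker_map /= fg subrr.
    by exists k => m x; rewrite /pe /pb /= kP.
  have E'I m (x y : E' m) : pe m x = pe m y -> pb m x = pb m y -> x = y.
    by move=> e1 e2; apply: (inc_inj m); rewrite !incE e1 e2.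
  have [un unP] := pairE _ a (al_unit B) qa.
  have solE s (f : forall m, P m -> E' m) : exists g : chain_map P E',
      chain_on (@sm_ker s) f ->
      (forall m x, sm_ker s x -> g m x = f m x) /\
      forall m x, pb m (g m x) = al_solve B s (fun m x => pb m (f m x)) m x.
    have [chf|nch] := pselect (chain_on (@sm_ker s) f); last first.
      by exists (cm_zero P E').
    pose beta := al_solve B s (fun m x => pb m (f m x)).
    have betaP := al_solveP (chain_on_map pb chf).
    (* A lift of [beta] to E solves the problem on the kernel up to an error in Y; the error extends
       to P, as Y is in the right orthogonal, and is subtracted. *)
    have [l lP] := projP (cm_comp b beta) (short_exact_epi jq).
    have /family_choice[phi phiP] : forall m (x : P m), exists y, sm_ker s x ->
        j m y = l m x - pe m (f m x).
      move=> m x; have [Kx|nKx] := pselect (sm_ker s x); last by exists 0.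
      have /(short_exactP jq)[y yE] : ker_map q (l m x - pe m (f m x)).
        by rewrite /ker_map linearB lP qpe /= betaP // subrr.
      by exists y.
    have j_inj := short_exact_mono jq.
    have [subK dK] := sm_sub s.
    have [peL ped] := chain_on_map pe chf.
    have phi_chain : chain_on (@sm_ker s) phi.
      split=> [m r x y Kx Ky|m x Kx].
        apply: (j_inj m); rewrite linearP !phiP //; last exact: (proj2 (subK m)).
        by rewrite linearP peL // scalerBr opprD addrACA.
      apply: (j_inj (m - 1)); rewrite cmap_diff !phiP //; last exact: dK.
      by rewrite linearB cmap_diff ped.
    have [theta thetaP] := right_orth_extends_small CY phi_chain.
    have [|g gP] := pairE P (cm_sub l (cm_comp j theta)) beta.
      by move=> m x; rewrite /= linearB (short_exact0 jq) subr0 lP.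
    exists g => _; split=> [m x Kx|m x]; last by case: (gP m x).
    have [g1 g2] := gP m x; apply: E'I; last by rewrite g2 /beta betaP.
    by rewrite g1 /= thetaP // phiP // opprB addrC subrK.
  have sol s f := cid (solE s f).
  pose A := @Algebra E' un (fun s f => sval (sol s f))
    (fun s f chf => (svalP (sol s f) chf).1).
  have [hAu hAs] := hA A.
  (* The composite is an algebra endomorphism of B, hence the identity. *)
  have pbh m x : pb m (h A m x) = x.
    rewrite -[RHS]hid; apply: (huni B (cm_comp pb (h A))).
    split=> [k z|s f chf k y] /=.
      by rewrite hAu; case: (unP k z).
    rewrite hAs //; exact: (svalP (sol s _) (chain_on_map (h A) chf)).2.
  exists (cm_comp pe (h A)); split=> [m z|m x] /=.
    by rewrite [h A _ _]hAu; case: (unP m z).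
  by rewrite -[X in b m X]pbh; apply: qpe.
Qed.

Lemma injective_disk_extends_small I : injective_module I -> extends_small (disk I).
Proof.
move=> injI s f [fL fd]; have [subK dK] := sm_sub s.
have aex m : exists a : {linear P m -> I}, forall x, sm_ker s x -> a x = (f m x).1.
  apply: (injI _ (@sm_ker s m) (fun x => (f m x).1)) => // r x y Kx Ky.
  by rewrite fL.
pose a m := sval (cid (aex m)).
have aP m x : sm_ker s x -> a m x = (f m x).1 by apply: (svalP (cid (aex m))).
have [g gP] := disk_map_exists a.
exists g => m x Kx; rewrite gP !aP //; last exact: dK.
by rewrite fd //; case: (f m x).
Qed.

(** A nonzero element of Z is detected by a map to a product of disks on an injective cogenerator,
    and that map factors through u. *)
Lemma extends_small_mono (B : complex R) (u : chain_map Z B) :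
  (forall (M : complex R) (f : chain_map Z M), extends_small M ->
     exists g : chain_map B M, forall m z, g m (u m z) = f m z) ->
  mono_map u.
Proof.
move=> uM m0 x y uxy; apply: contrapT => nxy.
have [I [injI cogI]] := injective_cogenerator_exists R.
have [||g [_ gxy]] := cogI (Z m0) (fun z => z = 0) (x - y).
- by split=> // r a b -> ->; rewrite scaler0 addr0.
- by move=> /subr0_eq.
have [f fP] := disk_map_exists
  (@dfwith _ _ (fun m => \0 : {linear Z m -> I}) m0 g).
have [k kP] := uM (disk I) f (injective_disk_extends_small injI).
have := kP m0 (x - y); rewrite !linearB uxy subrr => /esym.
by rewrite -linearB fP dfwith_in => -[/gxy].
Qed.

End Envelope.

Theorem complete_of_good_closed : complete_cotorsion_pair C (right_orth C).
Proof.
split; first split=> [Z|//].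
  by split=> [CZ X CX|]; [apply: CX|apply: C_left_orth].
move=> Z; split.
  have [F [p [projF p_surj]]] := cover_exists Z.
  have [K [i [i_inj iP]]] := subcomplex_exists (ker_subcomplex p).
  have ip : short_exact i p.
    by apply: mono_epi_short_exact => // m e; rewrite -iP.
  have [B [u [CB [uM llp]]]] := envelope_exists K.
  have [L [jB [k [o [jo jk ok Lgen Luni]]]]] := pushout_exists u ip.
  exists L, B, jB, o; split=> //; apply: C_left_orth => Y CY.
  apply/Ext1_zero_retract => E j q jq.
  (* A section over the pushout L is glued from a lift on F, by projectivity, and a lift on B that
     agrees with it on K, by the lifting property of K -> B. *)
  have [a aP] := projF _ _ q k (short_exact_epi jq).
  have [|v [vu qv]] := llp _ _ _ _ _ (cm_comp a i) jB jq CY.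
    by move=> m z; rewrite /= aP jk.
  have [|c [cj ck]] := Luni E v a; first by move=> m z; rewrite vu.
  apply: (retract_of_section jq (s := c)) => m l.
  by have [y [x ->]] := Lgen m l; rewrite !linearD cj ck qv aP.
have [B [u [CB [uM llp]]]] := envelope_exists Z.
have [L [w [w_surj wP]]] := quotient_complex_exists (im_subcomplex u).
exists L, B, u, w; split=> //; last first.
  by apply: mono_epi_short_exact => //; apply: extends_small_mono uM.
apply: C_left_orth => Y CY; apply/Ext1_zero_retract => E j q jq.
(* A lift of B -> B / Z that vanishes on Z descends to a section over B / Z. *)
have [|v [vu qv]] := llp _ _ _ _ _ (cm_zero Z E) w jq CY.
  by move=> m z; rewrite /= linear0; apply/esym/wP; exists z.
have [|s sP] := map_factor_epi (f := v) w_surj.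
  by move=> m x /wP[z <-]; rewrite /ker_map vu.
apply: (retract_of_section jq (s := s)) => m l.
by have [x <-] := w_surj m l; rewrite sP qv.
Qed.

End SmallObject.

(** * Complexes of modules of bounded flat dimension *)

Section Instances.
Variables (R : pzRingType) (n : nat).

Lemma dw_flat_good_sub (N X : complex R) (i : chain_map N X) :
  dw_flat n X -> mono_map i -> good (im_map i) -> dw_flat n N.
Proof.
move=> dwX i_inj [_ purei _] m; apply/flat_dim_tor.
by apply: (pure_sub_tor (i_inj m) (purei m)); apply/flat_dim_tor.
Qed.

Lemma dw_flat_good_quotient (X L : complex R) (q : chain_map X L) :
  dw_flat n X -> epi_map q -> good (ker_map q) -> dw_flat n L.
Proof.
move=> dwX q_surj [_ pureq _] m; apply/flat_dim_tor.
by apply: (pure_quotient_tor (q_surj m) (pureq m)); apply/flat_dim_tor.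
Qed.

Lemma exact_good_sub (N X : complex R) (i : chain_map N X) :
  exact_complex X -> mono_map i -> good (im_map i) -> exact_complex N.
Proof.
move=> exX i_inj [_ _ divi] m x dx.
have [|y dy] := exX m (i (m - 1) x); first by rewrite -cmap_diff dx linear0.
have [|_ [z <-] dz] := divi m y; first by exists x; rewrite dy.
by exists z; apply: (i_inj (m - 1)); rewrite cmap_diff dz.
Qed.

Lemma exact_good_quotient (X L : complex R) (q : chain_map X L) :
  exact_complex X -> epi_map q -> good (ker_map q) -> exact_complex L.
Proof.
move=> exX q_surj [_ _ divq] m l dl; have [x xl] := q_surj _ l.
have [|x' qx' dx'] := divq (m - 1) x; first by rewrite /ker_map cmap_diff xl.
have [|y dy] := exX m (x - x'); first by rewrite linearB dx' subrr.
by exists (q m y); rewrite -cmap_diff dy linearB qx' subr0.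
Qed.

(** A lifting problem in degree m becomes one between products of disks, with the zero map in all
    other degrees. *)
Lemma cprojective_projective (Q : complex R) m :
  cprojective Q -> projective (Q m).
Proof.
move=> projQ N N' q a q_surj.
have [f fP] := disk_map_exists (@dfwith _ _ (fun m => \0 : {linear Q m -> N'}) m a).
pose dq (k : int) (u : disk N k) : disk N' k := (q u.1, q u.2).
have dqL k : linear (@dq k) by move=> r u v; rewrite /dq !linearP.
have dqd k (u : disk N k) :
    dq (k - 1) (diff (disk N) k u) = diff (disk N') k (dq k u).
  by rewrite /dq /= linear0.
have [|g gP] := projQ _ _ (map_of dqL dqd) f.
  move=> k [u v]; have [x <-] := q_surj u; have [y <-] := q_surj v.
  by exists (x, y).
have [b bP] := disk_map_fst g m; exists b => x.
by have := gP m x; rewrite bP fP dfwith_in => -[].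
Qed.

(** * Disk complexes as tests for flat dimension *)

Section Tests.
Variables (K P L : lmodType R^c) (f : {linear K -> P}) (g : {linear P -> L}).
Variables (Y : lmodType R) (e : L -> Y -> QZ).
Hypotheses (g_surj : surjective g) (fgP : exact_at f g) (flatP : rflat P)
  (be : balanced e)
  (fullY : forall h : {additive L -> QZ}, exists c, forall x, e x c = h x)
  (sepY : forall c c', (forall x, e x c = e x c') -> c = c').

(** Y is the character module of L = P / K, so Ext^1(X m, Y) is the character group of Tor_1(L, X
    m), which vanishes here. The resulting degreewise retractions need no compatibility, as the
    target is a product of disks. *)
Lemma extends_left_disk (X : complex R) :
  (forall m, extends_left f (X m)) -> Ext1_zero X (disk Y).
Proof.
move=> extX; apply/Ext1_zero_retract => E i p ip.
have aex m : exists a : {linear E m -> Y}, forall u, a (i m u) = u.1.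
  have bt : balanced (fun (l : L) (u : disk Y m) => e l u.1).
    case: be => eD eD' eZ; split=> [l l' u|l u v|l r u].
    - exact: eD.
    - exact: eD'.
    - exact: eZ.
  have [t [bt' tP]] := extends_right_of_left g_surj fgP
    (short_exact_mono ip (m := m)) (short_exact_epi ip (m := m))
    (short_exactP ip (m := m)) flatP (extX m) bt.
  have [a aP] := bal_left_char bt' be fullY sepY.
  by exists a => u; apply: sepY => l; rewrite aP tP.
pose a m := sval (cid (aex m)).
have aP m u : a m (i m u) = u.1 by apply: (svalP (cid (aex m))).
have [r rP] := disk_map_exists a.
exists r => m u; rewrite rP aP -cmap_diff aP.
by case: u.
Qed.

(** A balanced map on L x Z' m, where Z' is the kernel of a projective cover, is a linear map to Y,
    hence a chain map to [disk Y]; it extends to the cover, and dimension shifting applies. *)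
Lemma disk_extends_left (Z : complex R) m :
  injective f -> Ext1_zero Z (disk Y) -> extends_left f (Z m).
Proof.
move=> f_inj extZ.
have [Q [q [projQ q_surj]]] := cover_exists Z.
have [Z' [i [i_inj iP]]] := subcomplex_exists (ker_subcomplex q).
have iq : short_exact i q.
  by apply: mono_epi_short_exact => // k x; rewrite -iP.
apply: (extends_left_of_right g_surj fgP (short_exact_epi iq (m := m))
  (short_exactP iq (m := m))).
  have flatQ := projective_lflat (cprojective_projective (m := m) projQ).
  exact: (flatQ _ _ f f_inj).
move=> t bt; have [a aP] := bal_left_char bt be fullY sepY.
have [h hP] := disk_map_exists (@dfwith _ _ (fun m => \0 : {linear Z' m -> Y}) m a).
have [h' h'P] := Ext1_zero_extend h iq extZ.
have [b bP] := disk_map_fst h' m.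
exists (fun l x => e l (b x)); split; first exact: bal_compr.
by move=> l x; rewrite bP h'P hP dfwith_in aP.
Qed.

End Tests.

Lemma left_orth_dw_flat (Z : complex R) :
  left_orth (right_orth (@dw_flat R n)) Z -> dw_flat n Z.
Proof.
move=> orthZ m; apply/flat_dim_tor => K P f syzf.
have subK : submodule (fun x => exists y, f y = x).
  split=> [|r _ _ [x <-] [y <-]]; first by exists 0; rewrite linear0.
  by exists (r *: x + y); rewrite linearP.
have [L [g [g_surj fgP]]] := quotient_exists subK.
have [Y [e [be fullY sepY]]] := left_character_exists L.
apply: (disk_extends_left g_surj fgP be fullY sepY (syzygy_mono_inj syzf)).
apply: orthZ => X dwX.
apply: (extends_left_disk g_surj fgP (syzygy_mono_rflat syzf) be fullY sepY).
by move=> k; have /flat_dim_tor := dwX k; apply.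
Qed.

(** * Complexes with zero differential as tests for exactness *)

Section Constant.
Variable I : lmodType R.

Definition constant : complex R :=
  @Complex R (fun=> I) (fun=> \0) (fun _ _ => erefl).

Lemma exact_constant (X : complex R) :
  injective_module I -> exact_complex X -> Ext1_zero X constant.
Proof.
move=> injI exX; apply/Ext1_zero_retract => E i p ip.
(* A retraction of complexes onto [constant] is, in each degree, a map that is the identity on I and
   kills boundaries. Degree m - 1 - 1 fits the form of [exact_complex]. *)
have aex m : exists a : {linear E (m - 1 - 1) -> I},
    (forall y, a (i _ y) = y) /\ forall e, a (diff E (m - 1) e) = 0.
  pose U (e : E (m - 1 - 1)) := exists y e', e = i _ y + diff E (m - 1) e'.
  (* If i(y - y') is the boundary of e' - e, then p(e' - e) is a cycle, hence a boundary. So e' - e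
     is a boundary plus an element of the image of i, and both have zero differential. *)
  have Ufun y y' e e' :
      i _ y + diff E (m - 1) e = i _ y' + diff E (m - 1) e' -> y = y'.
    move=> ye; have iyy : i _ (y - y') = diff E (m - 1) (e' - e).
      have transp (V : zmodType) (a b c d : V) : a + b = c + d -> a - c = d - b.
        move=> ab; apply/eqP.
        by rewrite subr_eq addrAC eq_sym subr_eq ab addrC.
      by rewrite !linearB; apply: transp.
    have [|x dx] := exX m (p _ (e' - e)).
      by rewrite -cmap_diff -iyy (short_exact0 ip).
    have [z zx] := short_exact_epi ip x.
    have /(short_exactP ip)[c ic] : ker_map p (e' - e - diff E m z).
      by rewrite /ker_map linearB cmap_diff zx dx subrr.
    have de : diff E (m - 1) (e' - e) = 0.
      rewrite -[e' - e](subrK (diff E m z)) -ic linearD diff_diff addr0.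
      by rewrite -cmap_diff /= linear0.
    by apply/subr0_eq/(short_exact_mono ip (m := m - 1 - 1)); rewrite iyy de linear0.
  have /choice[al alP] (v : E (m - 1 - 1)) : exists y, forall y' e',
      v = i _ y' + diff E (m - 1) e' -> y = y'.
    have [[y [e ->]]|nU] := pselect (U v).
      by exists y => y' e'; apply: Ufun.
    by exists 0 => y' e' v'; case: nU; exists y', e'.
  have subU : submodule U.
    split; first by exists 0, 0; rewrite !linear0 addr0.
    move=> r _ _ [y [e ->]] [y' [e' ->]]; exists (r *: y + y'), (r *: e + e').
    by rewrite !linearP scalerDr addrACA.
  have alL : linear_on U al.
    move=> r _ _ [y [e ->]] [y' [e' ->]].
    rewrite (alP _ y e erefl) (alP _ y' e' erefl).
    apply: (alP _ _ (r *: e + e')).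
    by rewrite !linearP scalerDr addrACA.
  have [a aP] := injI _ U al subU alL.
  exists a; split=> [y|e]; rewrite aP.
  - by apply: (alP _ _ 0); rewrite linear0 addr0.
  - by exists y, 0; rewrite linear0 addr0.
  - by apply: (alP _ _ e); rewrite linear0 add0r.
  - by exists 0, e; rewrite linear0 add0r.
(* Two shifts turn the maps in degrees m - 1 - 1 into a family over all degrees. *)
have [b bP] := degree_shift (F := fun k => {linear E (k - 1) -> I})
  (fun m => sval (cid (aex m))).
have [a aP] := degree_shift (F := fun k => {linear E k -> I}) b.
have shiftP (Q : int -> Prop) : (forall m, Q (m - 1)) -> forall m, Q m.
  by move=> h m; rewrite -(addrK 1 m).
have abP m : a (m - 1 - 1) = sval (cid (aex m)) by rewrite aP bP.
have ad k (x : E k) : a (k - 1) (diff E k x) = 0.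
  move: k x; apply: (shiftP _) => m x; rewrite abP.
  exact: (svalP (cid (aex m))).2.
exists (@ChainMap R E constant a ad).
apply: (shiftP _); apply: (shiftP _) => m y /=; rewrite abP.
exact: (svalP (cid (aex m))).1.
Qed.

Lemma constant_exact (Z : complex R) :
  (forall (M : lmodType R) (K : M -> Prop) x, submodule K -> ~ K x ->
     exists g : {linear M -> I}, (forall y, K y -> g y = 0) /\ g x <> 0) ->
  Ext1_zero Z constant -> exact_complex Z.
Proof.
move=> cogI extZ m x dx; apply: contrapT => nx.
have [|g [gd gx]] := cogI _ (fun x => exists y, diff Z m y = x) x _ nx.
  split=> [|r _ _ [a <-] [b <-]]; first by exists 0; rewrite linear0.
  by exists (r *: a + b); rewrite linearP.
pose phi := @dfwith _ _ (fun k => \0 : {linear Z k -> I}) (m - 1) g.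
have phid k z : phi (k - 1) (diff Z k z) = 0.
  have [e|km] := eqVneq k m.
    by move: z; rewrite e => z; rewrite /phi dfwith_in gd //; exists z.
  by rewrite /phi dfwith_out // (inj_eq (addIr _)) eq_sym.
(* The direct sum twisted by [phi]. The cycle x gives d(0, x) = (g x, 0), and a retraction onto a
   complex with zero differential would kill this boundary, forcing g x = 0. *)
pose d k (u : (I * Z k)%type) : (I * Z (k - 1))%type := (phi k u.2, diff Z k u.2).
have dL k : linear (@d k) by move=> r u v; rewrite /d !linearP.
have dd k u : lin_of (dL (k - 1)) (lin_of (dL k) u) = 0.
  by rewrite /= /d /= phid diff_diff.
pose E := @Complex R (fun k => (I * Z k)%type : lmodType R)
  (fun k => lin_of (dL k)) dd.
have iL k : linear (fun y : I => (y, 0) : E k).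
  by move=> r u v; congr pair; rewrite /= scaler0 addr0.
have idf k (y : constant k) : ((0, 0) : E (k - 1)) = diff E k (y, 0).
  by rewrite /= /d /= !linear0.
have pL k : linear (fun u : E k => u.2 : Z k) by [].
have pd k (u : E k) : (diff E k u).2 = diff Z k u.2 by [].
have ip : short_exact (@map_of R constant E _ iL idf) (@map_of R E Z _ pL pd).
  move=> k; split=> [y y' [] //|z|[y z]]; first by exists (0, z).
  by split=> [/= ->|[y' [_ <-]] //]; exists y.
have /Ext1_zero_retract/(_ _ _ _ ip)[r rP] := extZ.
apply: gx; rewrite -[LHS](rP (m - 1 - 1)).
have := cmap_diff r (0, x : Z (m - 1)) => /= <-; congr (r _ _).
by rewrite /d /= /phi dfwith_in dx.
Qed.

End Constant.

Lemma left_orth_ex_flat (Z : complex R) :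
  left_orth (right_orth (@ex_flat R n)) Z -> ex_flat n Z.
Proof.
move=> orthZ; split.
  apply: left_orth_dw_flat => Y orthY; apply: orthZ => X [dwX _].
  exact: orthY.
have [I [injI cogI]] := injective_cogenerator_exists R.
apply: (constant_exact cogI); apply: orthZ => X [_ exX].
exact: exact_constant.
Qed.

End Instances.

Theorem mainTheorem5 (R : pzRingType) (n : nat) (hn : (0 < n)%N) :
  complete_cotorsion_pair (@dw_flat R n) (right_orth (@dw_flat R n)) /\
  complete_cotorsion_pair (@ex_flat R n) (right_orth (@ex_flat R n)).
Proof.
have [P [projP skolemP]] := lowenheim_skolem R.
split; apply: (complete_of_good_closed projP skolemP).
- by move=> N X i; apply: dw_flat_good_sub.
- by move=> X L q; apply: dw_flat_good_quotient.
- exact: left_orth_dw_flat.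
- move=> N X i [dwX exX] i_inj goodi; split.
    exact: dw_flat_good_sub dwX i_inj goodi.
  exact: exact_good_sub exX i_inj goodi.
- move=> X L q [dwX exX] q_surj goodq; split.
    exact: dw_flat_good_quotient dwX q_surj goodq.
  exact: exact_good_quotient exX q_surj goodq.
- exact: left_orth_ex_flat.
Qed.
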